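(* For every $\varepsilon\in(0,1)$ and every integer $\ell\ge 2$ there exist constants $0<c\le C<\infty$, depending only on $\ell$ and $\varepsilon$, such that for every integer $n\ge 1$, every choice of connected graphs $G_1,\dots,G_n$ with vertex set $\{1,\dots,\ell\}$, and every integer $k\in\big[\varepsilon|V_G|,(1-\varepsilon)|V_G|\big]$, where $G=G_1\times\cdots\times G_n$ is the cartesian product, the inverse log-Sobolev constant of the $k$-particle exclusion process on $G$ satisfies $$c\ \le\ \rho^{\mathrm{ex}\text{-}k}_{G}\ \le\ C .$$
   Context: Graphs are finite, undirected and simple; $V_G$ and $E_G$ denote the vertex and edge sets of $G$. The cartesian product $G_1\times\cdots\times G_n$ has vertex set $V_{G_1}\times\cdots\times V_{G_n}$, and the neighbors of $x=(x_1,\dots,x_n)$ are obtained by replacing one arbitrary coordinate $x_i$ by an arbitrary neighbor of $x_i$ in $G_i$. So here $|V_G|=\ell^n$. For a finite connected graph $G$ and an integer $0<k<|V_G|$, the $k$-particle exclusion process on $G$ is the Markov chain on the set $\binom{V_G}{k}$ of $k$-element subsets of $V_G$ with generator $$\mathcal{L}^{\mathrm{ex}\text{-}k}_G f(S)=\sum_{e\in\partial S}\big(f(S\oplus e)-f(S)\big),$$ where $\oplus$ is symmetric difference and $\partial S$ is the edge-boundary of $S$ in $G$ (edges with exactly one endpoint in $S$). It is reversible with respect to the uniform law on $\binom{V_G}{k}$, and its Dirichlet form is $$\mathcal{E}^{\mathrm{ex}\text{-}k}_G(f)=\frac{1}{2\,|\binom{V_G}{k}|}\sum_{S\in\binom{V_G}{k}}\sum_{e\in\partial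 S}\big(f(S\oplus e)-f(S)\big)^2 .$$ The inverse log-Sobolev constant $\rho^{\mathrm{ex}\text{-}k}_G$ is the smallest number such that $$\mathbb{E}[f\log f]-\mathbb{E}[f]\log\mathbb{E}[f]\ \le\ \rho^{\mathrm{ex}\text{-}k}_G\,\mathcal{E}^{\mathrm{ex}\text{-}k}_G\big(\sqrt f\big)$$ for all $f:\binom{V_G}{k}\to(0,\infty)$, where $\mathbb{E}$ is expectation under the uniform law on $\binom{V_G}{k}$. *)

(* Defs.v *)
From HB Require Import structures.
From mathcomp Require Import all_boot all_order all_algebra.
From mathcomp Require Import reals exp.

Set Implicit Arguments.
Unset Strict Implicit.
Unset Printing Implicit Defensive.

Import Order.TTheory GRing.Theory Num.Theory.

Local Open Scope ring_scope.

Record sgraph (V : finType) := SGraph {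
  adj :> rel V;
  adj_sym : symmetric adj;
  adj_irrefl : irreflexive adj
}.

Definition connected_graph (V : finType) (G : sgraph V) : Prop :=
  forall x y : V, connect G x y.

Definition edges (V : finType) (G : sgraph V) : {set {set V}} :=
  [set [set x; y] | x in [set: V], y in [set: V] & G x y].

Definition edge_boundary (V : finType) (G : sgraph V) (S : {set V}) :
    {set {set V}} :=
  [set e in edges G | #|e :&: S| == 1%N].

Section CartesianProduct.
Variables (n : nat) (V : finType) (Gs : 'I_n -> sgraph V).

Definition cart_adj : rel {ffun 'I_n -> V} := fun x y =>
  [exists i, Gs i (x i) (y i) && [forall j, (j != i) ==> (x j == y j)]].

Fact cart_adj_sym : symmetric cart_adj.
Proof.
move=> x y; apply: eq_existsb => i; rewrite adj_sym; congr (_ && _).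
by apply: eq_forallb => j; rewrite eq_sym [x j == _]eq_sym.
Qed.

Fact cart_adj_irrefl : irreflexive cart_adj.
Proof. by move=> x; apply/existsP => -[i]; rewrite adj_irrefl. Qed.

Definition cart_prod : sgraph {ffun 'I_n -> V} :=
  SGraph cart_adj_sym cart_adj_irrefl.

End CartesianProduct.

Definition symdiff (V : finType) (A B : {set V}) : {set V} :=
  (A :\: B) :|: (B :\: A).

Definition ksubsets (V : finType) (k : nat) : {set {set V}} :=
  [set S : {set V} | #|S| == k].

(* Functions on k-subsets are represented by functions on all of {set V}, of
   which only the values on [ksubsets V k] matter: if [S] has k elements and
   [e] is a boundary edge of [S], then [symdiff S e] also has k elements. *)
Section Exclusion.
Variables (R : realType) (V : finType) (G : sgraph V) (k : nat).

Definition expect (f : {set V} -> R) : R :=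
  (\sum_(S in ksubsets V k) f S) / #|ksubsets V k|%:R.

Definition entropy (f : {set V} -> R) : R :=
  expect (fun S => f S * ln (f S)) - expect f * ln (expect f).

Definition dirichlet_ex (f : {set V} -> R) : R :=
  (2 * #|ksubsets V k|%:R)^-1 *
  \sum_(S in ksubsets V k) \sum_(e in edge_boundary G S)
    (f (symdiff S e) - f S) ^+ 2.

Definition log_sobolev_ineq (r : R) : Prop :=
  forall f : {set V} -> R, {in ksubsets V k, forall S, 0 < f S} ->
    entropy f <= r * dirichlet_ex (fun S => Num.sqrt (f S)).

Definition is_inverse_log_sobolev_constant (rho : R) : Prop :=
  log_sobolev_ineq rho /\ forall r : R, log_sobolev_ineq r -> rho <= r.

End Exclusion.

(* Main.v *)
Require Import Defs.
From mathcomp Require Import all_boot all_order all_algebra all_fingroup.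
From mathcomp Require classical_sets.
From mathcomp Require Import reals exp.
From mathcomp Require Import ring lra zify.

Set Implicit Arguments.
Unset Strict Implicit.
Unset Printing Implicit Defensive.

Import Order.TTheory GRing.Theory Num.Theory.

Local Open Scope ring_scope.

(** The exclusion process on [G] is compared with the one on the complete graph.

    For a star with [m] leaves of equal weight, the exclusion process satisfies
    the octopus inequality: the complete-graph form on the leaves is at most [m]
    times the star form.  It reduces to a spectral gap bound, which follows from
    the relation [D^2 = (N + 1) D - K] between the generators of the star and of
    the complete graph on [N = m + 1] sites, valid because functions of a subset
    do not carry the sign representation of three sites.

    In a hypercube of dimension [D], a vertex together with about [D / d]
    translates of it along disjoint sets of [d] coordinates forms a star, so the
    octopus inequality bounds the exchange energy at distance [2 d] by
    [2 (1 + O(d / D))] times the one at distance [d].  The errors are summable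
    over dyadic [d], hence the energy of antipodal pairs is at most a constant
    times the sum of the energies of the [D] edge directions.  Any two vertices
    of the product span such a cube, whose edges stay inside the lines of the
    product; inside a line, connectedness of [G_i] costs a constant depending on
    [l] only.

    The log-Sobolev inequality on the complete graph follows from the chain rule
    for the entropy, conditioning on the occupation of one site and averaging
    over this site.  The lower bound is tested on the difference between the
    numbers of particles in two layers. *)

(** * The octopus inequality for exclusion on a star *)

Section Swap.
Variable V : finType.
Implicit Types (x y z : V) (S : {set V}).

Definition swap x y S : {set V} := tperm x y @^-1: S.

Lemma swapxx x S : swap x x S = S.
Proof. by apply/setP => z; rewrite inE tperm1 perm1. Qed.

Lemma swapC x y S : swap x y S = swap y x S.
Proof. by apply/setP => z; rewrite !inE tpermC. Qed.

Lemma swapK x y : involutive (swap x y).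
Proof. by move=> S; apply/setP => z; rewrite !inE tpermK. Qed.

Lemma card_swap x y S : #|swap x y S| = #|S|.
Proof. by rewrite on_card_preimset //; apply: onW_bij; exists (tperm x y); apply: tpermK. Qed.

Lemma swap_conj x y z w S :
  swap z w (swap x y S) = swap x y (swap (tperm x y z) (tperm x y w) S).
Proof. by apply/setP => u; rewrite !inE -tpermJ permJ. Qed.

Lemma swap_same x y S : (x \in S) = (y \in S) -> swap x y S = S.
Proof.
by move=> xy; apply/setP => z; rewrite inE; case: tpermP => // ->; rewrite xy.
Qed.

Lemma swap_in_notin x y S : x \in S -> y \notin S -> swap x y S = y |: (S :\ x).
Proof.
move=> xS yS; apply/setP => z; rewrite !inE; case: tpermP => [->|->|/eqP zx /eqP zy].
- by rewrite (negPf yS) eqxx orbF; apply/esym/eqP => xy; move: yS; rewrite -xy xS.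
- by rewrite eqxx.
- by rewrite (negPf zy) zx.
Qed.

(* Two of the three sites carry the same occupation, so that on subsets the
   alternating sum over the symmetric group of three sites vanishes. *)
Lemma swap_alternating (R : comRingType) (f : {set V} -> R) x y z S :
  x != y -> x != z -> y != z ->
  f (swap x y (swap x z S)) + f (swap x z (swap x y S)) + f S =
  f (swap x y S) + f (swap x z S) + f (swap y z S).
Proof.
move=> xy xz yz.
have e1 T : swap x z (swap x y T) = swap x y (swap y z T).
  by rewrite swap_conj tpermL tpermD.
have e2 T : swap x y (swap x z T) = swap x z (swap y z T).
  by rewrite swap_conj tpermL tpermD ?[swap z y _]swapC // eq_sym.
have [e|nxy] := eqVneq (x \in S) (y \in S).
  have Sxy := swap_same e.
  have -> : swap x y (swap x z S) = swap y z S by rewrite -[in LHS]Sxy e1 swapK.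
  by rewrite Sxy; ring.
have [e|nxz] := eqVneq (x \in S) (z \in S).
  have Sxz := swap_same e.
  have -> : swap x z (swap x y S) = swap y z S by rewrite -[in LHS]Sxz e2 swapK.
  by rewrite Sxz; ring.
have Syz : swap y z S = S.
  by apply: swap_same; move: nxy nxz; do 3!case: (_ \in S).
by rewrite e1 e2 Syz; ring.
Qed.

End Swap.

Section Octopus.
Variables (R : realType) (V : finType).
Implicit Types (x y z w : V) (f g : {set V} -> R) (P : {set V}).

Definition dot f g : R := \sum_S f S * g S.

Definition exch x y f : {set V} -> R := fun S => f S - f (swap x y S).

(** Subsets of every size enter, without normalisation. The restriction to [k] particles comes later
    by extending a function by zero, since [swap] preserves the cardinality. *)
Definition exch_energy f x y : R := \sum_(S : {set V}) (f (swap x y S) - f S) ^+ 2.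

Lemma dotC f g : dot f g = dot g f.
Proof. by apply: eq_bigr => S _; rewrite mulrC. Qed.

Lemma dot_ge0 f : 0 <= dot f f.
Proof. by apply: sumr_ge0 => S _; rewrite -expr2 sqr_ge0. Qed.

Lemma eq_dot f1 f2 g1 g2 : f1 =1 f2 -> g1 =1 g2 -> dot f1 g1 = dot f2 g2.
Proof. by move=> ef eg; apply: eq_bigr => S _; rewrite ef eg. Qed.

Lemma dot_suml (I : finType) (A : pred I) (F : I -> {set V} -> R) g :
  dot (fun S => \sum_(i | A i) F i S) g = \sum_(i | A i) dot (F i) g.
Proof.
by rewrite exchange_big /=; apply: eq_bigr => S _; rewrite mulr_suml.
Qed.

Lemma dot_sumr (I : finType) (A : pred I) (F : I -> {set V} -> R) g :
  dot g (fun S => \sum_(i | A i) F i S) = \sum_(i | A i) dot g (F i).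
Proof. by rewrite dotC dot_suml; apply: eq_bigr => i _; apply: dotC. Qed.

Lemma dotBl f1 f2 g : dot (fun S => f1 S - f2 S) g = dot f1 g - dot f2 g.
Proof. by rewrite -sumrB; apply: eq_bigr => S _; rewrite mulrBl. Qed.

Lemma dotBr f1 f2 g : dot g (fun S => f1 S - f2 S) = dot g f1 - dot g f2.
Proof. by rewrite dotC dotBl !(dotC g). Qed.

Lemma dotZl c f g : dot (fun S => c * f S) g = c * dot f g.
Proof. by rewrite /dot mulr_sumr; apply: eq_bigr => S _; rewrite mulrA. Qed.

Lemma dotZr c f g : dot f (fun S => c * g S) = c * dot f g.
Proof. by rewrite dotC dotZl dotC. Qed.

Lemma dot_cauchy f g : dot f g ^+ 2 <= dot f f * dot g g.
Proof.
have [g0|gn0] := eqVneq (dot g g) 0.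
  have g00 S : g S = 0.
    have /psumr_eq0P/(_ g0 S isT)/eqP : forall S, true -> 0 <= g S * g S.
      by move=> T _; rewrite -expr2 sqr_ge0.
    by rewrite mulf_eq0 orbb => /eqP.
  rewrite g0 mulr0 [dot f g]big1 ?expr0n // => S _.
  by rewrite g00 mulr0.
have gp : 0 < dot g g by rewrite lt_neqAle eq_sym gn0 dot_ge0.
have := dot_ge0 (fun S => dot g g * f S - dot f g * g S).
rewrite dotBl !dotBr !dotZl !dotZr (dotC g f) => h.
have : 0 <= dot g g * (dot f f * dot g g - dot f g ^+ 2).
  by apply: le_trans h _; rewrite le_eqVlt; apply/orP; left; apply/eqP; ring.
by rewrite pmulr_rge0 // subr_ge0.
Qed.

Lemma exchxx x f S : exch x x f S = 0.
Proof. by rewrite /exch swapxx subrr. Qed.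

Lemma exchC x y f : exch x y f =1 exch y x f.
Proof. by move=> S; rewrite /exch swapC. Qed.

Lemma exchK x y f S : exch x y (exch x y f) S = 2 * exch x y f S.
Proof. by rewrite /exch swapK; ring. Qed.

Lemma eq_exch x y f g : f =1 g -> exch x y f =1 exch x y g.
Proof. by move=> fg S; rewrite /exch !fg. Qed.

Lemma exch_adj x y f g : dot (exch x y f) g = dot f (exch x y g).
Proof.
rewrite /exch (dotBl f (f \o swap x y)) (dotBr g (g \o swap x y)); congr (_ - _).
rewrite [LHS](reindex_inj (inv_inj (swapK x y))) /=.
by apply: eq_bigr => S _; rewrite swapK.
Qed.

Lemma exch_sum (I : finType) (A : pred I) (F : I -> {set V} -> R) x y S :
  exch x y (fun S => \sum_(i | A i) F i S) S = \sum_(i | A i) exch x y (F i) S.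
Proof. by rewrite /exch sumrB. Qed.

Lemma dot_exch_self x y f : dot (exch x y f) (exch x y f) = 2 * dot f (exch x y f).
Proof. by rewrite exch_adj -dotZr; apply: eq_dot => // S; apply: exchK. Qed.

Lemma exch_energyE f x y : exch_energy f x y = 2 * dot f (exch x y f).
Proof.
by rewrite -dot_exch_self; apply: eq_bigr => S _; rewrite /exch; ring.
Qed.

(** This is [swap_alternating] rewritten for the operators 1 - swap. The last term corrects the case
    [y = z], where the square of an exchange is twice the exchange. *)
Lemma exch_anticomm x y z f S :
  exch x y (exch x z f) S + exch x z (exch x y f) S =
  exch x y f S + exch x z f S - exch y z f S + (y == z)%:R * (2 * exch x y f S).
Proof.
have [->|yz] := eqVneq y z; first by rewrite exchK exchxx mul1r; ring.
rewrite mul0r addr0.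
have [->|xy] := eqVneq x y; first by rewrite /exch /= !swapxx; ring.
have [->|xz] := eqVneq x z; first by rewrite /exch /= !swapxx (swapC z y); ring.
by have := swap_alternating f S xy xz yz; rewrite /exch /= => e; lra.
Qed.

Definition star_op P x f : {set V} -> R := fun S => \sum_(y in P) exch x y f S.

(* Each pair of sites is counted twice. *)
Definition complete_op P f : {set V} -> R :=
  fun S => \sum_(y in P) \sum_(z in P) exch y z f S.

Lemma sum_indic P y (c : R) : y \in P -> \sum_(z in P) (y == z)%:R * c = c.
Proof.
move=> yP; rewrite (bigD1 y) //= eqxx mul1r big1 ?addr0 // => z /andP[_ /negPf zy].
by rewrite eq_sym zy mul0r.
Qed.

(** Symmetrise the double sum defining D^2 and apply [exch_anticomm] to each pair; the diagonal
    correction raises the coefficient from |P| to |P| + 1. *)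
Lemma star_op_sq P x f S :
  2 * star_op P x (star_op P x f) S =
  2 * (#|P|%:R + 1) * star_op P x f S - complete_op P f S.
Proof.
have -> : star_op P x (star_op P x f) S =
    \sum_(y in P) \sum_(z in P) exch x y (exch x z f) S.
  by apply: eq_bigr => y _; rewrite /star_op exch_sum.
pose F y z := exch x y (exch x z f) S.
have -> : 2 * (\sum_(y in P) \sum_(z in P) F y z) =
    \sum_(y in P) \sum_(z in P) (F y z + F z y).
  under [RHS]eq_bigr do rewrite big_split.
  by rewrite big_split /= [X in _ = _ + X]exchange_big /=; ring.
have -> : \sum_(y in P) \sum_(z in P) (F y z + F z y) =
    \sum_(y in P) (exch x y f S * #|P|%:R + star_op P x f S
      - star_op P y f S + 2 * exch x y f S).
  apply: eq_bigr => y yP.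
  under eq_bigr => z zP do rewrite exch_anticomm.
  by rewrite big_split /= sumrB big_split /= sumr_const sum_indic // mulr_natr.
rewrite big_split /= sumrB big_split /= sumr_const -mulr_sumr -mulr_suml.
rewrite -/(star_op P x f S) /complete_op /star_op.
by set A := \sum_(y in P) _; set B := \sum_(y in P) _; rewrite -(mulr_natr B); ring.
Qed.

(** Exchanges on disjoint pairs commute and each is twice a projection, so the inner product is a
    quarter of the squared norm of the composition applied to [f]. *)
Lemma exch_disjoint_ge0 x y z w f : z != x -> z != y -> w != x -> w != y ->
  0 <= dot (exch x y f) (exch z w f).
Proof.
move=> zx zy wx wy.
have comm g : exch z w (exch x y g) =1 exch x y (exch z w g).
  move=> S; rewrite /exch /= [swap z w (swap x y S)]swap_conj.
  by rewrite !tpermD 1?eq_sym //; ring.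
have h : 2 * (2 * dot (exch x y f) (exch z w f)) =
    dot (exch x y (exch z w f)) (exch x y (exch z w f)).
  rewrite dot_exch_self; congr (2 * _).
  rewrite -dotZr -(eq_dot (fun=> erefl) (exchK z w f)) -exch_adj.
  by rewrite (eq_dot (comm f) (fun=> erefl)) exch_adj.
by have := dot_ge0 (exch x y (exch z w f)); rewrite -h; lra.
Qed.

Lemma dot_star_op P x f :
  dot (star_op P x f) (star_op P x f) =
  (#|P|%:R + 1) * dot f (star_op P x f) - 2^-1 * dot f (complete_op P f).
Proof.
have -> : dot (star_op P x f) (star_op P x f) = dot f (star_op P x (star_op P x f)).
  rewrite [LHS]dot_suml [RHS]dot_sumr.
  by apply: eq_bigr => y _; rewrite exch_adj.
have e S : star_op P x (star_op P x f) S =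
    (#|P|%:R + 1) * star_op P x f S - 2^-1 * complete_op P f S.
  by have := star_op_sq P x f S; lra.
by rewrite (eq_dot (fun=> erefl) e) dotBr !dotZr.
Qed.

(* Expanding the square, the pairs of exchanges that share a site reproduce the
   right-hand side, and the pairs of disjoint exchanges contribute nonnegatively. *)
Lemma complete_op_gap P f :
  2 * #|P|%:R * dot f (complete_op P f) <= dot (complete_op P f) (complete_op P f).
Proof.
pose b x y z w := dot (exch x y f) (exch z w f).
have bC x y z w : b x y z w = b y x z w by apply: eq_dot => // S; apply: exchC.
have bC' x y z w : b x y z w = b x y w z by apply: eq_dot => // S; apply: exchC.
have bxx x z w : b x x z w = 0.
  by rewrite /b /dot big1 // => S _; rewrite exchxx mul0r.
have bxx' x y z : b x y z z = 0.
  by rewrite /b /dot big1 // => S _; rewrite exchxx mulr0.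
have bself x y : b x y x y = 2 * dot f (exch x y f) by apply: dot_exch_self.
pose s4 (F : V -> V -> V -> V -> R) :=
  \sum_(x in P) \sum_(y in P) \sum_(z in P) \sum_(w in P) F x y z w.
have lhs : dot (complete_op P f) (complete_op P f) = s4 b.
  rewrite dot_suml; apply: eq_bigr => x _; rewrite dot_suml.
  apply: eq_bigr => y _; rewrite dot_sumr.
  by apply: eq_bigr => z _; rewrite dot_sumr.
(* Inclusion-exclusion over the ways in which the pairs meet: four terms for a shared site, two
   subtractions when both sites agree and were counted twice. Disjoint pairs are bounded below by
   0. *)
have ptw x y z w : (x == z)%:R * b x y x w + (y == z)%:R * b x y y w
    + (x == w)%:R * b x y z x + (y == w)%:R * b x y z y
    - (x == z)%:R * ((y == w)%:R * b x y x y)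
    - (x == w)%:R * ((y == z)%:R * b x y x y) <= b x y z w.
  have [<-|xy] := eqVneq x y; first by rewrite !bxx; rewrite /=; lra.
  have [<-|zw] := eqVneq z w.
    rewrite !bxx' [b x y x z]bC' [b x y y z]bC'.
    have [e|xz] := eqVneq x z.
      by subst z; rewrite eq_sym (negPf xy) bxx'; rewrite /=; lra.
    by have [<-|yz] := eqVneq y z; rewrite ?bxx'; rewrite /=; lra.
  have [exz|xz] := eqVneq x z.
    subst z; rewrite [y == x]eq_sym (negPf xy) (negPf zw).
    have [<-|yw] := eqVneq y w; rewrite /=; lra.
  have [eyz|yz] := eqVneq y z.
    subst z; rewrite (negPf zw).
    have [<-|xw] := eqVneq x w; last by rewrite /=; lra.
    by rewrite [b x y y x]bC'; rewrite /=; lra.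
  have [<-|xw] := eqVneq x w; first by rewrite [y == x]eq_sym (negPf xy); rewrite /=; lra.
  have [<-|yw] := eqVneq y w; first by rewrite /=; lra.
  suff : 0 <= b x y z w by rewrite /=; lra.
  by apply: exch_disjoint_ge0; rewrite eq_sym.
(* Each shared-site term sums to [t], the sum over [x] of the squared norms of [star_op P x f],
   which [dot_star_op] evaluates; each double coincidence sums to [d]. *)
pose t := \sum_(x in P) \sum_(y in P) \sum_(z in P) b x y x z.
have t1 : s4 (fun x y z w => (x == z)%:R * b x y x w) = t.
  apply: eq_bigr => x xP; apply: eq_bigr => y yP; rewrite exchange_big /=.
  by apply: eq_bigr => w wP; rewrite sum_indic.
have t2 : s4 (fun x y z w => (y == z)%:R * b x y y w) = t.
  rewrite /s4 exchange_big; apply: eq_bigr => x xP; apply: eq_bigr => y yP.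
  rewrite exchange_big; apply: eq_bigr => w wP; rewrite sum_indic //; exact: bC.
have t3 : s4 (fun x y z w => (x == w)%:R * b x y z x) = t.
  apply: eq_bigr => x xP; apply: eq_bigr => y yP.
  by apply: eq_bigr => w wP; rewrite sum_indic // bC'.
have t4 : s4 (fun x y z w => (y == w)%:R * b x y z y) = t.
  rewrite /s4 exchange_big; apply: eq_bigr => x xP; apply: eq_bigr => y yP.
  by apply: eq_bigr => w wP; rewrite sum_indic // bC' bC.
pose d := \sum_(x in P) \sum_(y in P) b x y x y.
have t5 : s4 (fun x y z w => (x == z)%:R * ((y == w)%:R * b x y x y)) = d.
  apply: eq_bigr => x xP; apply: eq_bigr => y yP.
  under eq_bigr => z zP do rewrite -mulr_sumr sum_indic //.
  by rewrite sum_indic.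
have t6 : s4 (fun x y z w => (x == w)%:R * ((y == z)%:R * b x y x y)) = d.
  apply: eq_bigr => x xP; apply: eq_bigr => y yP; rewrite exchange_big /=.
  under eq_bigr => z zP do rewrite -mulr_sumr sum_indic //.
  by rewrite sum_indic.
have tE : t = (#|P|%:R / 2 + 1) * dot f (complete_op P f).
  have -> : t = \sum_(x in P) dot (star_op P x f) (star_op P x f).
    apply: eq_bigr => x _; rewrite [RHS]dot_suml; apply: eq_bigr => y _.
    by rewrite dot_sumr.
  under eq_bigr => x _ do rewrite dot_star_op.
  rewrite sumrB -mulr_sumr -dot_sumr sumr_const -[_ *+ #|P|]mulr_natl.
  by rewrite -/(complete_op P f); field.
have dE : d = 2 * dot f (complete_op P f).
  rewrite dot_sumr mulr_sumr; apply: eq_bigr => x _.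
  by rewrite dot_sumr mulr_sumr; apply: eq_bigr => y _; apply: bself.
have : s4 (fun x y z w => (x == z)%:R * b x y x w + (y == z)%:R * b x y y w
    + (x == w)%:R * b x y z x + (y == w)%:R * b x y z y
    - (x == z)%:R * ((y == w)%:R * b x y x y)
    - (x == w)%:R * ((y == z)%:R * b x y x y)) <= s4 b.
  by do 4!(apply: ler_sum => ? _); apply: ptw.
have s4D F G : s4 (fun x y z w => F x y z w + G x y z w) = s4 F + s4 G.
  by rewrite /s4 -big_split; apply: eq_bigr => ? _; rewrite -big_split;
     apply: eq_bigr => ? _; rewrite -big_split; apply: eq_bigr => ? _; rewrite -big_split.
have s4N F : s4 (fun x y z w => - F x y z w) = - s4 F.
  by rewrite /s4 -sumrN; apply: eq_bigr => ? _; rewrite -sumrN;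
     apply: eq_bigr => ? _; rewrite -sumrN; apply: eq_bigr => ? _; rewrite -sumrN.
rewrite !s4D !s4N t1 t2 t3 t4 t5 t6 -lhs tE dE; lra.
Qed.

Lemma star_op_adj P x f g : dot (star_op P x f) g = dot f (star_op P x g).
Proof.
by rewrite dot_suml dot_sumr; apply: eq_bigr => y _; apply: exch_adj.
Qed.

Lemma star_op_lin P x (a b : R) f g S :
  star_op P x (fun S => a * f S + b * g S) S = a * star_op P x f S + b * star_op P x g S.
Proof.
rewrite /star_op !mulr_sumr -big_split; apply: eq_bigr => y _.
by rewrite /exch /=; ring.
Qed.

Lemma complete_op_ge0 P f : 0 <= dot f (complete_op P f).
Proof.
rewrite dot_sumr; apply: sumr_ge0 => y _; rewrite dot_sumr; apply: sumr_ge0 => z _.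
suff : 0 <= 2 * dot f (exch y z f) by lra.
by rewrite -dot_exch_self dot_ge0.
Qed.

(** Since K is nonnegative, D^2 is at most (|P| + 1) D; Cauchy-Schwarz turns this into a bound on D
    itself. *)
Lemma star_op_le P x f : dot f (star_op P x f) <= (#|P|%:R + 1) * dot f f.
Proof.
have c := dot_cauchy f (star_op P x f).
have := complete_op_ge0 P f; have := dot_star_op P x f.
have f0 := dot_ge0 f; have N0 : 0 <= #|P|%:R :> R by rewrite ler0n.
set a := dot f (star_op P x f) in c *; set n := #|P|%:R => e k0.
have [a0|ap] := lerP a 0; first by apply: le_trans a0 _; apply: mulr_ge0 => //; lra.
rewrite -(ler_pM2r ap) -expr2; apply: le_trans c _; rewrite e.
rewrite [leRHS](_ : _ = dot f f * ((n + 1) * a)); last by ring.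
by apply: ler_wpM2l => //; lra.
Qed.

(** Conjugation by the transposition of [x] and [y] permutes the pairs of sites of [P]. *)
Lemma complete_op_exch P x y f S : x \in P -> y \in P ->
  complete_op P (exch x y f) S = exch x y (complete_op P f) S.
Proof.
move=> xP yP; pose G z w := f (swap z w S).
pose F z w := f (swap x y (swap z w S)).
have e : \sum_(z in P) \sum_(w in P) F z w =
    \sum_(z in P) \sum_(w in P) f (swap z w (swap x y S)).
  have tP z : (tperm x y z \in P) = (z \in P).
    by case: tpermP => [->|->|//]; rewrite xP yP.
  rewrite (reindex_inj (@perm_inj _ (tperm x y))) (eq_bigl _ _ tP).
  apply: eq_bigr => z _.
  rewrite (reindex_inj (@perm_inj _ (tperm x y))) (eq_bigl _ _ tP).
  by apply: eq_bigr => w _; rewrite /F -swap_conj.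
rewrite /complete_op /exch -sumrB; apply/eqP; rewrite -subr_eq0.
under [X in _ - X]eq_bigr do rewrite -sumrB.
rewrite -sumrB; under eq_bigr do rewrite -sumrB.
rewrite (eq_bigr (fun z => \sum_(w in P) (F z w - f (swap z w (swap x y S))))).
  by under eq_bigr do rewrite sumrB; rewrite sumrB e subrr.
by move=> z _; apply: eq_bigr => w _; rewrite /F; ring.
Qed.

(* With [D] the star operator and [K = D (N + 1 - D)] the complete-graph one,
     N (N^2 - 1) (D^2 - D) = (N - 1 + 2 D) (K^2 - N K)
                             + (D^2 - D) (3 N + 1 - 2 D) (D^2 - D),
   and both terms on the right are nonnegative. *)
Lemma star_op_gap P x f : x \in P ->
  dot f (star_op P x f) <= dot (star_op P x f) (star_op P x f).
Proof.
move=> xP; pose n : R := #|P|%:R.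
have [P1|P2] := leqP #|P| 1.
  have PE : P = [set x].
    by apply/esym/eqP; rewrite eqEcard sub1set xP cards1.
  have D0 : star_op P x f =1 fun=> 0.
    by move=> S; rewrite /star_op PE big_set1 exchxx.
  by rewrite [dot f _]big1 ?dot_ge0 // => S _; rewrite D0 mulr0.
have n2 : 2 <= n by rewrite ler_nat.
(* By self-adjointness, m_j is the moment <f, D^j f>; the inequalities [q1] to [q4] are linear in
   these moments. *)
pose D := star_op P x; pose v1 := D f; pose v2 := D v1; pose v3 := D v2.
pose m1 := dot f v1; pose m2 := dot v1 v1; pose m3 := dot v1 v2.
pose m4 := dot v2 v2; pose m5 := dot v2 v3.
have D_adj g h : dot (D g) h = dot g (D h) by apply: star_op_adj.
have m13 : dot v1 v3 = m4 by rewrite -D_adj.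
have LE g S : complete_op P g S = 2 * (n + 1) * D g S + (- 2) * D (D g) S.
  by have := star_op_sq P x g S; rewrite -/n /D; lra.
pose u S := 2 * (n + 1) * v1 S + (- 2) * v2 S.
have Lu : complete_op P f =1 u by move=> S; rewrite LE.
have Du : D u =1 fun S => 2 * (n + 1) * v2 S + (- 2) * v3 S.
  by move=> S; apply: star_op_lin.
have dot_lin a b a' b' g h g' h' :
    dot (fun S => a * g S + b * h S) (fun S => a' * g' S + b' * h' S) =
    a * a' * dot g g' + a * b' * dot g h' + b * a' * dot h g' + b * b' * dot h h'.
  rewrite /dot !mulr_sumr -!big_split; apply: eq_bigr => S _ /=; ring.
have dot_linr a' b' g g' h' : dot g (fun S => a' * g' S + b' * h' S) =
    a' * dot g g' + b' * dot g h'.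
  rewrite /dot !mulr_sumr -!big_split; apply: eq_bigr => S _ /=; ring.
have q1 : 2 * n * (2 * (n + 1) * m1 - 2 * m2) <=
    4 * (n + 1) ^+ 2 * m2 - 8 * (n + 1) * m3 + 4 * m4.
  have := complete_op_gap P f.
  rewrite (eq_dot (fun=> erefl) Lu) (eq_dot Lu Lu) dot_linr dot_lin.
  rewrite -/m1 -/m2 -/m3 -/m4 (dotC v2 v1) -/m3 (_ : dot f v2 = m2); last first.
    by rewrite -D_adj.
  by rewrite -/n; lra.
(* The bound [complete_op_gap] is applied to each [exch x y f] and summed over [y]. As K commutes
   with these exchanges, the result is that D (K^2 - N K) is nonnegative. *)
have q2 : 2 * n * (2 * (n + 1) * m2 - 2 * m3) <=
    4 * (n + 1) ^+ 2 * m3 - 8 * (n + 1) * m4 + 4 * m5.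
  have : \sum_(y in P) 2 * n * dot (exch x y f) (complete_op P (exch x y f)) <=
      \sum_(y in P) dot (complete_op P (exch x y f)) (complete_op P (exch x y f)).
    by apply: ler_sum => y _; apply: complete_op_gap.
  rewrite (eq_bigr (fun y => 2 * n * (2 * dot (exch x y f) u))); last first.
    move=> y yP; congr (_ * _).
    rewrite (eq_dot (fun=> erefl) (fun S => complete_op_exch f S xP yP)) -exch_adj.
    by rewrite (eq_dot (exchK x y f) Lu) dotZl.
  rewrite -mulr_sumr -mulr_sumr -[X in _ * (2 * X)]dot_suml.
  rewrite [leRHS](eq_bigr (fun y => 2 * dot (exch x y u) u)); last first.
    move=> y yP.
    have e S : complete_op P (exch x y f) S = exch x y u S.
      by rewrite complete_op_exch // (eq_exch _ _ Lu).
    by rewrite (eq_dot e e) dot_exch_self dotC.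
  rewrite -mulr_sumr -[X in _ <= _ * X]dot_suml.
  change (2 * n * (2 * dot v1 u) <= 2 * dot (D u) u -> 
    2 * n * (2 * (n + 1) * m2 - 2 * m3) <=
    4 * (n + 1) ^+ 2 * m3 - 8 * (n + 1) * m4 + 4 * m5).
  rewrite (eq_dot Du (fun=> erefl)) [in leRHS]dot_lin dot_linr.
  rewrite (dotC v3) (dotC v3) (dotC v2 v1) -/m2 -/m3 -/m4 -/m5 m13.
  by lra.
(* The upper bound on D, taken at the vector D^2 f - D f; [q4] is the squared norm of the same
   vector. *)
have q3 : m5 - 2 * m4 + m3 <= (n + 1) * (m4 - 2 * m3 + m2).
  have := star_op_le P x (fun S => 1 * v2 S + (- 1) * v1 S).
  rewrite (eq_dot (fun=> erefl) (star_op_lin P x _ _ _ _)) !dot_lin.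
  rewrite -/(D v2) -/(D v1) -/v3 -/v2 m13 (dotC v2 v1) -/m2 -/m3 -/m4 -/m5.
  by rewrite -/n; lra.
have q4 : 0 <= m4 - 2 * m3 + m2.
  have := dot_ge0 (fun S => 1 * v2 S + (- 1) * v1 S).
  by rewrite dot_lin (dotC v2 v1) -/m2 -/m3 -/m4; lra.
rewrite -/v1 -/m1 -/m2 -subr_ge0.
have np : 0 < 2 * n * (n ^+ 2 - 1).
  by rewrite !mulr_gt0 ?subr_gt0 ?exprn_egt1 //; lra.
rewrite -(pmulr_rge0 _ np).
pose Q1 := 4 * (n + 1) ^+ 2 * m2 - 8 * (n + 1) * m3 + 4 * m4
           - 2 * n * (2 * (n + 1) * m1 - 2 * m2).
pose Q2 := 4 * (n + 1) ^+ 2 * m3 - 8 * (n + 1) * m4 + 4 * m5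
           - 2 * n * (2 * (n + 1) * m2 - 2 * m3).
pose Q3 := (n + 1) * (m4 - 2 * m3 + m2) - (m5 - 2 * m4 + m3).
(* Twice the operator identity above, with 2 (3 N + 1 - 2 D) split as 4 (N + 1 - D) + 2 (N - 1). *)
have -> : 2 * n * (n ^+ 2 - 1) * (m2 - m1) =
   (n - 1) / 2 * Q1 + Q2 + 4 * Q3 + 2 * (n - 1) * (m4 - 2 * m3 + m2).
  by rewrite /Q1 /Q2 /Q3; field.
have Q1p : 0 <= Q1 by rewrite subr_ge0.
have Q2p : 0 <= Q2 by rewrite subr_ge0.
have Q3p : 0 <= Q3 by rewrite subr_ge0.
have h1 : 0 <= (n - 1) / 2 * Q1 by apply: mulr_ge0 => //; lra.
have h2 : 0 <= 2 * (n - 1) * (m4 - 2 * m3 + m2) by apply: mulr_ge0 => //; lra.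
lra.
Qed.

Lemma exch_energyxx f x : exch_energy f x x = 0.
Proof.
by rewrite /exch_energy big1 // => S _; rewrite swapxx subrr expr0n.
Qed.

Lemma exch_energyC f x y : exch_energy f x y = exch_energy f y x.
Proof. by apply: eq_bigr => S _; rewrite swapC. Qed.

Lemma exch_energy_ge0 f x y : 0 <= exch_energy f x y.
Proof. by apply: sumr_ge0 => S _; apply: sqr_ge0. Qed.

(** With D^2 = (N + 1) D - K, the gap D <= D^2 reads K <= N D, where N = |Y| + 1. Removing from K
    its star part D leaves the bound |Y| D for the leaves; the factor 2 counts ordered pairs. *)
Lemma octopus (Y : {set V}) x f : x \notin Y ->
  \sum_(y in Y) \sum_(z in Y) exch_energy f y z <=
  2 * #|Y|%:R * \sum_(y in Y) exch_energy f x y.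
Proof.
move=> xY; pose P := x |: Y.
have gap := star_op_gap f (setU11 x Y : x \in P).
have e1 : dot f (star_op P x f) = 2^-1 * \sum_(y in Y) exch_energy f x y.
  rewrite dot_sumr big_setU1 //= mulr_sumr.
  rewrite [X in X + _]big1 => [|S _]; last by rewrite exchxx mulr0.
  by rewrite add0r; apply: eq_bigr => y _; rewrite exch_energyE; field.
have e2 : dot f (complete_op P f) =
    \sum_(y in Y) exch_energy f x y +
    2^-1 * \sum_(y in Y) \sum_(z in Y) exch_energy f y z.
  have -> : dot f (complete_op P f) =
      2^-1 * \sum_(y in P) \sum_(z in P) exch_energy f y z.
    rewrite dot_sumr mulr_sumr; apply: eq_bigr => y _.
    rewrite dot_sumr mulr_sumr; apply: eq_bigr => z _.
    by rewrite exch_energyE; field.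
  rewrite big_setU1 //= big_setU1 //= exch_energyxx add0r.
  under [X in _ + X]eq_bigr => y _ do rewrite big_setU1 //= exch_energyC.
  by rewrite big_split /=; field.
have e3 : #|P|%:R = 1 + #|Y|%:R :> R by rewrite cardsU1 xY natrD.
move: gap; rewrite dot_star_op e1 e2 e3; lra.
Qed.

End Octopus.

(** * Distance doubling in the hypercube *)

Lemma perm_of_card (T : finType) (A B : {set T}) :
  #|A| = #|B| -> exists p : {perm T}, p @: A = B.
Proof.
move=> AB; pose sA := enum A ++ enum (~: A); pose sB := enum B ++ enum (~: B).
have mem C z : z \in enum (C : {set T}) ++ enum (~: C).
  by rewrite mem_cat !mem_enum inE orbN.
have uni C : uniq (enum (C : {set T}) ++ enum (~: C)).
  rewrite cat_uniq !enum_uniq andbT; apply/hasPn => z.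
  by rewrite !mem_enum inE.
have szc : size sA = size sB.
  by rewrite !size_cat -!cardE; have := cardsC A; have := cardsC B; lia.
pose h z := nth z sB (index z sA).
have ltA z : (index z sA < size sB)%N by rewrite -szc index_mem mem.
have h_inj : injective h.
  move=> y z; rewrite /h (set_nth_default z) // => /eqP.
  rewrite nth_uniq ?uni // => /eqP e.
  by rewrite -[y](nth_index y (mem A y)) e (set_nth_default z) ?szc // nth_index ?mem.
exists (perm h_inj); apply/eqP; rewrite eqEcard card_imset ?AB ?leqnn ?andbT; last exact: perm_inj.
apply/subsetP => _ /imsetP[z zA ->]; rewrite permE /h index_cat mem_enum zA.
rewrite nth_cat -cardE -AB cardE index_mem mem_enum zA.
by rewrite -mem_enum mem_nth // -cardE -AB cardE index_mem mem_enum.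
Qed.

Lemma in_symdiff (T : finType) (A B : {set T}) z :
  (z \in symdiff A B) = (z \in A) (+) (z \in B).
Proof. by rewrite !inE; do 2!case: (z \in _). Qed.

Lemma symdiffK (T : finType) (A : {set T}) : involutive (symdiff A).
Proof. by move=> B; apply/setP => z; rewrite !in_symdiff addbA addbb. Qed.

Lemma imset_symdiff (aT rT : finType) (h : aT -> rT) (A B : {set aT}) :
  injective h -> h @: symdiff A B = symdiff (h @: A) (h @: B).
Proof.
move=> h_inj; apply/setP => z; rewrite in_symdiff.
have [/codomP[w ->]|zh] := boolP (z \in codom h).
  by rewrite !mem_imset // in_symdiff.
have notin (C : {set aT}) : (z \in h @: C) = false.
  by apply/imsetP => -[w _ zw]; rewrite zw codom_f in zh.
by rewrite !notin.
Qed.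

Section SetFunction.
Variables (R : realType) (T : finType) (phi : {set T} -> R).

(** The octopus inequality in abstract form: [phi A] stands for the energy between a vertex of the
    hypercube and its translate by [A]. The members of [F] are the leaves of a star centred at the
    empty set. *)
Definition symdiff_octopus (phi : {set T} -> R) := forall F : {set {set T}},
  set0 \notin F -> \sum_(A in F) \sum_(B in F) phi (symdiff A B) <=
    2 * #|F|%:R * \sum_(A in F) phi A.

(** Symmetrisation over the coordinates: the result depends on the cardinality only and still
    satisfies the octopus inequality, which is linear in [phi]. *)
Definition perm_sum (A : {set T}) : R := \sum_(p : {perm T}) phi (p @: A).

Lemma perm_sum_card (A B : {set T}) : #|A| = #|B| -> perm_sum A = perm_sum B.
Proof.
move=> /perm_of_card[p <-]; rewrite /perm_sum (reindex_inj (mulgI p)) /=.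
apply: eq_bigr => q _; rewrite -imset_comp; congr phi; apply: eq_imset => x.
by rewrite /= permM.
Qed.

Lemma perm_sum_octopus : symdiff_octopus phi -> symdiff_octopus perm_sum.
Proof.
move=> H F F0.
rewrite [leRHS](_ : _ = \sum_(p : {perm T}) (2 * #|F|%:R * \sum_(A in F) phi (p @: A))); last first.
  by rewrite -mulr_sumr exchange_big.
have -> : \sum_(A in F) \sum_(B in F) perm_sum (symdiff A B) =
  \sum_(p : {perm T}) \sum_(A in F) \sum_(B in F) phi (symdiff (p @: A) (p @: B)).
  rewrite [RHS]exchange_big /=; apply: eq_bigr => A _.
  rewrite [RHS]exchange_big /=; apply: eq_bigr => B _.
  by apply: eq_bigr => p _; rewrite imset_symdiff //; apply: perm_inj.
apply: ler_sum => p _.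
have p_inj : injective (fun A : {set T} => p @: A) by apply/imset_inj/perm_inj.
have := H [set p @: A | A : {set T} in F]; rewrite card_imset //.
have E (G : {set T} -> R) :
    \sum_(A in [set p @: A | A : {set T} in F]) G A = \sum_(A in F) G (p @: A).
  by rewrite big_imset //; apply: in2W.
rewrite !E; under eq_bigr => A _ do rewrite E.
by apply; apply/imsetP => -[A AF /esym/eqP]; rewrite imset_eq0 => /eqP A0; rewrite -A0 AF in F0.
Qed.

Lemma card_symdiff (A B : {set T}) :
  #|symdiff A B| = (#|A| - #|A :&: B| + (#|B| - #|A :&: B|))%N.
Proof.
rewrite /symdiff cardsU !cardsD [B :&: A]setIC.
rewrite [X in (_ - X)%N](_ : _ = 0%N) ?subn0 //.
by apply/eqP; rewrite cards_eq0; apply/eqP/setP => z; rewrite !inE; do 2!case: (_ \in _).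
Qed.

(** Intervals of the enumeration of [T] supply sets with prescribed sizes and intersections. *)
Definition segment (a b : nat) : {set T} := [set x | (a <= enum_rank x < b)%N].

Lemma card_segment a b : (b <= #|T|)%N -> #|segment a b| = (b - a)%N.
Proof.
move=> bT; have h (i : 'I_(b - a)) : (a + i < #|T|)%N by have := ltn_ord i; lia.
have <- : [set enum_val (Ordinal (h i)) | i : 'I_(b - a)] = segment a b.
  apply/setP => x; rewrite inE; apply/imsetP/idP => [[i _ ->]|/andP[ax xb]].
    by rewrite enum_valK /=; case: i => i /= ?; lia.
  have hi : (enum_rank x - a < b - a)%N by lia.
  exists (Ordinal hi) => //; rewrite -[LHS]enum_rankK; congr enum_val.
  by apply: val_inj; rewrite /= subnKC.
rewrite card_imset ?card_ord // => i j /enum_val_inj /(congr1 val) /= /addnI.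
exact: val_inj.
Qed.

Lemma segmentI a b c d : segment a b :&: segment c d = segment (maxn a c) (minn b d).
Proof. by apply/setP => x; rewrite !inE; lia. Qed.

Hypothesis phi_ge0 : forall A : {set T}, 0 <= phi A.
Hypothesis phi_card : forall A B : {set T}, #|A| = #|B| -> phi A = phi B.
Hypothesis phi_octopus : symdiff_octopus phi.

Definition profile (c : nat) : R := phi (segment 0 c).

Lemma profileE (A : {set T}) : phi A = profile #|A|.
Proof. by apply: phi_card; rewrite card_segment ?subn0 // max_card. Qed.

Lemma profile_triangle a b c : (c <= a)%N -> (c <= b)%N -> (a + b - c <= #|T|)%N ->
  profile (a + b - c.*2) <= 2 * profile a + 2 * profile b.
Proof.
move=> ca cb abT; pose A := segment 0 a; pose B := segment (a - c) (a + b - c).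
have cA : #|A| = a by rewrite card_segment ?subn0 //; lia.
have cB : #|B| = b by rewrite card_segment; lia.
have cAB : #|A :&: B| = c by rewrite segmentI card_segment; lia.
have <- : phi (symdiff A B) = profile (a + b - c.*2).
  by rewrite profileE card_symdiff cA cB cAB; congr profile; lia.
have pA : phi A = profile a by rewrite profileE cA.
have pB : phi B = profile b by rewrite profileE cB.
rewrite -pA -pB; have pA0 := phi_ge0 A; have pB0 := phi_ge0 B.
have symd0 (C : {set T}) : symdiff set0 C = C by rewrite /symdiff set0D setD0 set0U.
have symdC (C D : {set T}) : symdiff C D = symdiff D C by rewrite /symdiff setUC.
(* A star with the two leaves [A] and [B] needs them nonempty and distinct; the degenerate cases
   follow from positivity or from a star with one leaf. *)
have [->|A0] := eqVneq A set0.
  by rewrite symd0; have := phi_ge0 set0; lra.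
have [->|B0] := eqVneq B set0.
  by rewrite symdC symd0; have := phi_ge0 set0; lra.
have [<-|AB] := eqVneq A B.
  have h : set0 \notin [set A] by rewrite inE eq_sym.
  have := phi_octopus h; by rewrite !big_set1 cards1; lra.
have h : set0 \notin [set A; B] by rewrite !inE ![set0 == _]eq_sym negb_or A0.
have := phi_octopus h; rewrite !big_setU1 ?inE //= !big_set1 cards2 AB.
rewrite !big_setU1 ?inE //= !big_set1 (symdC B A).
by have := phi_ge0 (symdiff A A); have := phi_ge0 (symdiff B B); lra.
Qed.

(** The star has [M] disjoint blocks of size [d] as leaves: its M (M - 1) ordered pairs of distinct
    leaves are at distance 2 d, and the diagonal is dropped. *)
Lemma profile_double M d : (0 < d)%N -> (M * d <= #|T|)%N ->
  M%:R * (M%:R - 1) * profile d.*2 <= 2 * M%:R ^+ 2 * profile d.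
Proof.
move=> d0 MdT; pose A (j : 'I_M) := segment (j * d) (j * d + d).
have jd (j : 'I_M) : (j * d + d <= M * d)%N by rewrite addnC -mulSn leq_mul2r ltn_ord orbT.
have cA j : #|A j| = d by rewrite card_segment; have := jd j; lia.
have AI i j : i != j -> #|A i :&: A j| = 0%N.
  move=> ij; rewrite segmentI card_segment; last by have := jd i; lia.
  have : (i < j)%N || (j < i)%N by rewrite -neq_ltn.
  by move=> /orP[] lt; have := leq_mul lt (leqnn d); rewrite mulSn; lia.
have A_inj : injective A.
  move=> i j Aij; apply/eqP/negPn/negP => ij.
  by have := AI i j ij; rewrite Aij setIid cA; lia.
pose F := [set A j | j : 'I_M].
have F0 : set0 \notin F.
  by apply/imsetP => -[j _ e]; have := cA j; rewrite -e cards0; lia.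
have := phi_octopus F0; rewrite card_imset // card_ord.
have E (G : {set T} -> R) : \sum_(B in F) G B = \sum_j G (A j).
  by rewrite big_imset //; apply: in2W.
rewrite !E; under eq_bigr => j _ do rewrite E.
rewrite [X in _ <= _ * X](eq_bigr (fun=> profile d)); last first.
  by move=> j _; rewrite profileE cA.
rewrite sumr_const card_ord -[profile d *+ M]mulr_natl => h.
apply: le_trans (_ : _ <= 2 * M%:R * (M%:R * profile d)) _; last first.
  by rewrite le_eqVlt; apply/orP; left; apply/eqP; ring.
apply: le_trans _ h.
have -> : M%:R * (M%:R - 1) * profile d.*2 = \sum_(i < M) (M%:R - 1) * profile d.*2.
  by rewrite sumr_const card_ord -[(_ * _) *+ M]mulr_natl mulrA.
apply: ler_sum => i _; rewrite (bigD1 i) //=.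
rewrite (eq_bigr (fun=> profile d.*2)); last first.
  move=> j ji; rewrite profileE card_symdiff !cA AI 1?eq_sym //.
  by congr profile; lia.
rewrite sumr_const cardC1 card_ord -[profile _ *+ _]mulr_natl.
rewrite -{1}(prednK (leq_ltn_trans (leq0n i) (ltn_ord i))) -natr1 addrK.
by rewrite lerDr.
Qed.

(** With M = |T| / d rounded down, M / (M - 1) is at most 1 + 2 d / |T|, because |T| <= 2 d (M - 1)
    once M is at least 4. *)
Lemma profile_pow2_step d : (0 < d)%N -> (4 * d <= #|T|)%N ->
  #|T|%:R * profile d.*2 <= (2 * #|T|%:R + 4 * d%:R) * profile d.
Proof.
move=> d0 dT; pose M := (#|T| %/ d)%N.
have M4 : (4 <= M)%N by rewrite leq_divRL.
have MdT : (M * d <= #|T|)%N by apply: leq_trunc_div.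
have TMd : (#|T| <= 2 * d * M.-1)%N.
  have := ltn_ceil #|T| d0; rewrite -/M -(prednK (ltn_trans (isT : 0 < 3)%N M4)) /=.
  have : (d * 3 <= d * M.-1)%N by rewrite leq_mul2l; lia.
  by rewrite mulSn; lia.
have := profile_double d0 MdT.
have p1 := phi_ge0 (segment 0 d); have p2 := phi_ge0 (segment 0 d.*2).
move: p1 p2; rewrite -!/(profile _); set x := profile d; set y := profile d.*2 => x0 y0.
have T0 : 0 <= #|T|%:R :> R by rewrite ler0n.
have TMdR : #|T|%:R <= 2 * d%:R * (M%:R - 1) :> R.
  have -> : M%:R - 1 = M.-1%:R :> R by rewrite -subn1 natrB //; lia.
  by rewrite -!natrM ler_nat.
have m0 : 4 <= M%:R :> R by rewrite ler_nat.
set m := M%:R in TMdR m0 *; set t := #|T|%:R in T0 TMdR *; set e := d%:R in TMdR * => h.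
have {h}h : (m - 1) * y <= 2 * m * x.
  have m_gt0 : 0 < m by lra.
  by rewrite -(ler_pM2l m_gt0); move: h; rewrite expr2 !mulrA (mulrC m 2).
have h1 : t * x <= 2 * e * (m - 1) * x by apply: ler_wpM2r.
have h2 : t * ((m - 1) * y) <= t * (2 * m * x) by apply: ler_wpM2l.
have m1 : 0 < m - 1 by lra.
rewrite -(ler_pM2l m1).
have -> : (m - 1) * (t * y) = t * ((m - 1) * y) by ring.
apply: le_trans h2 _.
have -> : (m - 1) * ((2 * t + 4 * e) * x) = 2 * t * (m - 1) * x + 2 * (2 * e * (m - 1) * x).
  by ring.
have -> : t * (2 * m * x) = 2 * t * (m - 1) * x + 2 * (t * x) by ring.
lra.
Qed.

(** The factor 1 + 4 * 2^j / |T| absorbs the errors of all earlier doublings: with d = 2^j, the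
    induction step leaves a slack proportional to |T| - 4 d. *)
Lemma profile_pow2 j : j = 0%N \/ (2 * 2 ^ j <= #|T|)%N ->
  #|T|%:R * profile (2 ^ j) <= 2 ^+ j * (#|T|%:R + 4 * 2 ^+ j) * profile 1.
Proof.
have p1 := phi_ge0 (segment 0 1); rewrite -/(profile 1) in p1.
have T0 : 0 <= #|T|%:R :> R by rewrite ler0n.
elim: j => [|j IH] hj.
  by rewrite expn0 expr0 mul1r mulrDl lerDl; apply: mulr_ge0 => //; lra.
have {hj}hj : (4 * 2 ^ j <= #|T|)%N by case: hj => //; rewrite expnS; lia.
have step := profile_pow2_step (expn_gt0 2 j : (0 < 2 ^ j)%N = true) hj.
have {}IH := IH (or_intror (leq_trans (leq_mul (isT : 2 <= 4)%N (leqnn _)) hj)).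
move: step; rewrite expnS mul2n natrX exprS.
have : 4 * 2 ^+ j <= #|T|%:R :> R by rewrite -natrX -natrM ler_nat.
have : 0 < 2 ^+ j :> R by rewrite exprn_gt0.
have : 0 < #|T|%:R :> R.
  by rewrite ltr0n; apply: leq_trans hj; rewrite muln_gt0 expn_gt0.
move: IH; set t := #|T|%:R in T0 *; set d := 2 ^+ j.
set x := profile 1 in p1 *; set y := profile (2 ^ j); set z := profile _.
move=> IH t_gt0 d0 dt step; rewrite -(ler_pM2l t_gt0).
have h1 : t * (t * z) <= t * ((2 * t + 4 * d) * y) by apply: ler_wpM2l.
have h2 : (2 * t + 4 * d) * (t * y) <= (2 * t + 4 * d) * (d * (t + 4 * d) * x).
  by apply: ler_wpM2l => //; lra.
apply: le_trans h1 _.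
have -> : t * ((2 * t + 4 * d) * y) = (2 * t + 4 * d) * (t * y) by ring.
apply: le_trans h2 _; rewrite -subr_ge0.
have -> : t * (2 * d * (t + 4 * (2 * d)) * x) - (2 * t + 4 * d) * (d * (t + 4 * d) * x)
  = 4 * d ^+ 2 * x * (t - 4 * d) by ring.
by rewrite !mulr_ge0 ?subr_ge0 ?exprn_ge0 //; lra.
Qed.

Lemma profile_full : phi set0 = 0 -> profile #|T| <= 40 * #|T|%:R * profile 1.
Proof.
move=> phi0; have p1 := phi_ge0 (segment 0 1); rewrite -/(profile 1) in p1.
have p0 : profile 0 = 0 by rewrite -(cards0 T) -profileE.
have [T1|T2] := leqP #|T| 1.
  case: #|T| T1 => [|[|//]] _; first by rewrite p0; lra.
  by rewrite /=; lra.
(* A power of two with 2 d <= |T| < 4 d. Splitting |T| into 2 d and a remainder below 2 d costs at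
   most 24 [profile d] + 4 [profile 1]; with [pd] this is at most 38 |T| [profile 1]. *)
pose d := (2 ^ trunc_log 2 #|T|./2)%N.
have d0 : (0 < d)%N by rewrite expn_gt0.
have d2 : (2 * d <= #|T|)%N.
  have h : (0 < #|T|./2)%N by lia.
  by have := trunc_logP (isT : 1 < 2)%N h; rewrite -/d; lia.
have d4 : (#|T| < 4 * d)%N.
  have := trunc_log_ltn #|T|./2 (isT : 1 < 2)%N; rewrite expnS -/d; lia.
have pd : profile d <= 3 / 2 * #|T|%:R * profile 1.
  have := profile_pow2 (or_intror d2); rewrite -natrX -/d.
  have : 2 * d%:R <= #|T|%:R :> R by rewrite -natrM ler_nat.
  have : 0 < #|T|%:R :> R by rewrite ltr0n; lia.
  have : 0 <= d%:R :> R by rewrite ler0n.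
  set t := #|T|%:R; set e := d%:R; move=> e0 t0 et h.
  rewrite -(ler_pM2l t0); apply: le_trans h _; rewrite -subr_ge0.
  have -> : t * (3 / 2 * t * profile 1) - e * (t + 4 * e) * profile 1 =
     profile 1 * ((t - 2 * e) * (3 / 2 * t + 2 * e)) by field.
  by rewrite mulr_ge0 // mulr_ge0; lra.
have even c : (c <= d)%N -> profile c.*2 <= 4 * profile d.
  move=> cd; have h : (d + d - (d - c) <= #|T|)%N by lia.
  have := profile_triangle (leq_subr c d) (leq_subr c d) h.
  rewrite (_ : d + d - (d - c).*2 = c.*2)%N; first by lra.
  by lia.
have pd0 := phi_ge0 (segment 0 d); rewrite -/(profile d) in pd0.
have small c : (c < 2 * d)%N -> profile c <= 8 * profile d + 2 * profile 1.
  move=> cd; have c2 : (c./2 <= d)%N by lia.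
  have := even _ c2; have [codd|ceven] := boolP (odd c); last first.
    by rewrite (_ : c./2.*2 = c) => [|]; [lra | lia].
  have h : (c./2.*2 + 1 - 0 <= #|T|)%N by lia.
  have := profile_triangle (leq0n _) (leq0n _) h.
  rewrite (_ : c./2.*2 + 1 - 0.*2 = c)%N; first by lra.
  by lia.
have h : (d.*2 + (#|T| - d.*2) - 0 <= #|T|)%N by lia.
have := profile_triangle (leq0n _) (leq0n _) h.
rewrite (_ : d.*2 + (#|T| - d.*2) - 0.*2 = #|T|)%N; last by lia.
have h1 := even d (leqnn d).
have h2 := small (#|T| - d.*2)%N (ltac:(lia)).
have h3 : 2 * profile 1 <= #|T|%:R * profile 1 by rewrite ler_wpM2r // ler_nat.
lra.
Qed.

End SetFunction.

(** The full set and the sum over singletons are both invariant under permutations, so the bound for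
    the symmetrised function descends to [phi]. *)
Lemma octopus_setT (R : realType) (T : finType) (phi : {set T} -> R) :
  (forall A, 0 <= phi A) -> phi set0 = 0 -> symdiff_octopus phi ->
  phi setT <= 40 * \sum_t phi [set t].
Proof.
move=> phi_ge0 phi0 H; pose psi := perm_sum phi.
have psi_ge0 A : 0 <= psi A by apply: sumr_ge0.
have psi0 : psi set0 = 0 by rewrite /psi /perm_sum big1 // => p _; rewrite imset0.
have psi_card (A B : {set T}) : #|A| = #|B| -> psi A = psi B by apply: perm_sum_card.
have := profile_full psi_ge0 psi_card (perm_sum_octopus H) psi0.
have -> : profile psi #|T| = #|{perm T}|%:R * phi setT.
  rewrite -cardsT -(profileE psi_card).
  rewrite /psi /perm_sum (eq_bigr (fun=> phi setT)) => [|p _].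
    by rewrite sumr_const mulr_natl.
  congr phi; apply/setP => x; rewrite inE -(permKV p x) mem_imset ?inE //.
  exact: perm_inj.
have -> : 40 * #|T|%:R * profile psi 1 = #|{perm T}|%:R * (40 * \sum_t phi [set t]).
  have : #|T|%:R * profile psi 1 = \sum_t psi [set t].
    rewrite (eq_bigr (fun=> profile psi 1)) => [|t _].
      by rewrite sumr_const mulr_natl.
    by rewrite (profileE psi_card) cards1.
  rewrite -mulrA => ->; rewrite mulrCA; congr (_ * _).
  rewrite exchange_big /= (eq_bigr (fun=> \sum_t phi [set t])) => [|p _].
    by rewrite sumr_const mulr_natl.
  rewrite [RHS](reindex_inj (@perm_inj _ p)); apply: eq_bigr => t _.
  by rewrite imset_set1.
by rewrite ler_pM2l // ltr0n; apply/card_gt0P; exists 1%g.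
Qed.

(** * Comparison on product graphs *)

Section Cube.
Variables (R : realType) (I W : finType) (f : {set {ffun I -> W}} -> R).
Implicit Types (x y : {ffun I -> W}) (U : {set I}).

Definition mix x y U : {ffun I -> W} := [ffun i => if i \in U then y i else x i].

Lemma cube_antipodal x y :
  \sum_U exch_energy f (mix x y U) (mix x y (~: U)) <=
  40 * \sum_U \sum_i exch_energy f (mix x y U) (mix x y (symdiff [set i] U)).
Proof.
(* Only the coordinates where [x] and [y] differ are kept: distinct subsets of [T] then give
   distinct vertices, as the leaves of a star must be. *)
pose T : finType := {i : I | x i != y i}.
pose flip (A : {set T}) U := symdiff [set val t | t in A] U.
have in_flip (A : {set T}) U (t : T) : (val t \in flip A U) = (t \in A) (+) (val t \in U).
  by rewrite in_symdiff mem_imset //; apply: val_inj.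
(* Summing over the base vertex [U] gives translation invariance: the energy between the translates
   by [A] and by [B] becomes [phi (symdiff A B)]. *)
pose phi (A : {set T}) := \sum_U exch_energy f (mix x y U) (mix x y (flip A U)).
have phi_ge0 A : 0 <= phi A by apply: sumr_ge0 => U _; apply: exch_energy_ge0.
have phi0 : phi set0 = 0.
  rewrite /phi big1 // => U _; rewrite (_ : flip set0 U = U) ?exch_energyxx //.
  by apply/setP => z; rewrite in_symdiff imset0 inE.
have mix_inj U (A B : {set T}) : mix x y (flip A U) = mix x y (flip B U) -> A = B.
  move=> /ffunP e; apply/setP => t; have := e (val t); rewrite !ffunE !in_flip.
  have /negPf txy : x (val t) != y (val t) by case: t.
  by do 3![case: (_ \in _)] => //= /eqP; rewrite ?txy // eq_sym txy.
have phi_octopus : symdiff_octopus phi.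
  move=> F F0.
  have -> : \sum_(A in F) \sum_(B in F) phi (symdiff A B) =
      \sum_U \sum_(A in F) \sum_(B in F)
        exch_energy f (mix x y (flip A U)) (mix x y (flip B U)).
    rewrite [RHS]exchange_big /=; apply: eq_bigr => A AF.
    rewrite [RHS]exchange_big /=; apply: eq_bigr => B BF.
    rewrite /phi (reindex_inj (inv_inj (symdiffK [set val t | t in A]))) /=.
    apply: eq_bigr => U _; congr (exch_energy f _ (mix x y _)).
    apply/setP => z; rewrite !in_symdiff.
    rewrite imset_symdiff; last exact: val_inj.
    rewrite in_symdiff; by do 3!case: (z \in _).
  rewrite [X in _ <= _ * X]exchange_big /= mulr_sumr; apply: ler_sum => U _.
  pose Y := [set mix x y (flip A U) | A in F].
  have YE (G : {ffun I -> W} -> R) :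
      \sum_(v in Y) G v = \sum_(A in F) G (mix x y (flip A U)).
    by rewrite big_imset //; move=> A B _ _; apply: mix_inj.
  have e0 : mix x y U = mix x y (flip set0 U).
    by congr mix; apply/setP => z; rewrite in_symdiff imset0 inE.
  have xY : mix x y U \notin Y.
    apply/imsetP => -[A AF]; rewrite e0 => /mix_inj A0.
    by rewrite A0 AF in F0.
  have := octopus f xY; rewrite !YE card_in_imset; last by move=> A B _ _; apply: mix_inj.
  by apply: le_trans; rewrite le_eqVlt; apply/orP; left; apply/eqP/eq_bigr => A _; rewrite YE.
have := octopus_setT phi_ge0 phi0 phi_octopus.
have -> : phi setT = \sum_U exch_energy f (mix x y U) (mix x y (~: U)).
  apply: eq_bigr => U _; congr exch_energy; apply/ffunP => i; rewrite !ffunE.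
  have [e|ne] := eqVneq (x i) (y i); first by rewrite e !if_same.
  have -> : (i \in flip setT U) = ~~ (i \in U).
    by have := in_flip setT U (exist _ i ne); rewrite in_setT.
  by rewrite in_setC.
move=> /le_trans; apply; rewrite ler_wpM2l //.
rewrite [leRHS]exchange_big /=.
rewrite (eq_bigr (fun t => \sum_U exch_energy f (mix x y U) (mix x y (symdiff [set val t] U)))).
  rewrite -(big_imset (fun i => \sum_U exch_energy f (mix x y U) (mix x y (symdiff [set i] U)))
     (in2W val_inj)) /=.
  rewrite [leRHS](bigID [in [set val t | t : T]]) /= lerDl.
  by apply: sumr_ge0 => i _; apply: sumr_ge0 => U _; apply: exch_energy_ge0.
by move=> t _; apply: eq_bigr => U _; rewrite /flip imset_set1.
Qed.

(** The two points exchange their coordinates in [U]. As an involution of pairs, this serves as a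
    change of variables in sums over all pairs. *)
Definition mix2 U (p : {ffun I -> W} * {ffun I -> W}) :=
  (mix p.1 p.2 U, mix p.1 p.2 (~: U)).

Lemma mix2K U : involutive (mix2 U).
Proof.
by case=> x y; congr (_, _); apply/ffunP => i; rewrite !ffunE /= !inE; case: (i \in U).
Qed.

(** Sum [cube_antipodal] over all pairs. For fixed [U], the change of variables [mix2 U] turns an
    antipodal pair into an arbitrary pair, and a cube edge into a change of one coordinate to an
    arbitrary value. *)
Lemma antipodal_coordinate :
  \sum_x \sum_y exch_energy f x y <=
  40 * \sum_i \sum_x \sum_y exch_energy f x (mix x y [set i]).
Proof.
have U0 : 0 < #|{set I}|%:R :> R by rewrite ltr0n; apply/card_gt0P; exists set0.
rewrite -(ler_pM2l U0).
have -> : #|{set I}|%:R * (\sum_x \sum_y exch_energy f x y) =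
    \sum_x \sum_y \sum_U exch_energy f (mix x y U) (mix x y (~: U)).
  rewrite [RHS]pair_big /= [RHS]exchange_big /=.
  rewrite [RHS](eq_bigr (fun=> \sum_x \sum_y exch_energy f x y)) => [|U _].
    by rewrite sumr_const mulr_natl.
  rewrite [RHS]pair_big /= [RHS](reindex_inj (inv_inj (mix2K U))) /=.
  by apply: eq_bigr.
have -> : #|{set I}|%:R *
      (40 * \sum_i \sum_x \sum_y exch_energy f x (mix x y [set i])) =
    \sum_x \sum_y 40 * \sum_U \sum_i exch_energy f (mix x y U) (mix x y (symdiff [set i] U)).
  rewrite [RHS]pair_big /= -mulr_sumr [in RHS]exchange_big /= mulrCA; congr (_ * _).
  rewrite [RHS](eq_bigr (fun=> \sum_i \sum_x \sum_y exch_energy f x (mix x y [set i]))) => [|U _].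
    by rewrite sumr_const mulr_natl.
  rewrite exchange_big /=; apply: eq_bigr => i _.
  rewrite [RHS]pair_big /= [RHS](reindex_inj (inv_inj (mix2K U))) /=.
  apply: eq_bigr => -[x y] _ /=; congr exch_energy; apply/ffunP => j.
  by rewrite !ffunE /= in_symdiff !inE; case: (j == i); case: (j \in U).
apply: ler_sum => x _; apply: ler_sum => y _; exact: cube_antipodal.
Qed.

(** The octopus inequality for the star with centre [y] and leaves [x] and [z]. *)
Lemma exch_energy_triangle (V : finType) (g : {set V} -> R) (x y z : V) :
  exch_energy g x z <= 2 * exch_energy g x y + 2 * exch_energy g y z.
Proof.
have nonneg u v := exch_energy_ge0 g u v.
have [->|yx] := eqVneq y x; first by rewrite exch_energyxx; have := nonneg x z; lra.
have [->|yz] := eqVneq y z; first by rewrite exch_energyxx; have := nonneg x z; lra.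
have [->|xz] := eqVneq x z.
  by rewrite exch_energyxx; have := nonneg z y; have := nonneg y z; lra.
have := @octopus R V [set x; z] y g; rewrite !inE negb_or yx yz => /(_ isT).
rewrite !big_setU1 ?inE //= !big_set1 !big_setU1 ?inE //= !big_set1 cards2 xz.
by rewrite !exch_energyxx (exch_energyC g z x) (exch_energyC g y x) /=; lra.
Qed.

Lemma connected_energy (G : sgraph W) (e : W -> W -> R) :
  connected_graph G -> (forall a b, 0 <= e a b) -> (forall a, e a a = 0) ->
  (forall a b c, e a c <= 2 * e a b + 2 * e b c) ->
  forall a b, e a b <= 2 ^+ #|W| * \sum_c \sum_(d | G c d) e c d.
Proof.
move=> Gc e0 exx tri a b; set S := \sum_c _.
have S0 : 0 <= S by apply: sumr_ge0 => c _; apply: sumr_ge0 => d _.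
have eS c d : G c d -> e c d <= S.
  move=> cd; rewrite /S (bigD1 c) //= (bigD1 d) //=.
  have h1 : 0 <= \sum_(j | G c j && (j != d)) e c j by apply: sumr_ge0.
  have h2 : 0 <= \sum_(i | i != c) \sum_(j | G i j) e i j.
    by apply: sumr_ge0 => i _; apply: sumr_ge0.
  lra.
(* The triangle inequality gives the recursion c_(m+1) = 2 + 2 c_m with c_0 = 0, whose solution is 2
   * 2^m - 2. A simple path then has fewer than |W| edges. *)
have walk p : forall c, path G c p -> e c (last c p) <= (2 * 2 ^+ size p - 2) * S.
  elim: p => [|d p IH] c /=; first by rewrite exx expr0; lra.
  move=> /andP[/eS cd /IH {}IH]; apply: le_trans (tri c d _) _.
  by rewrite exprS; lra.
have /connectP[p pp ->] := Gc a b; case/shortenP: pp => q qp uq _.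
apply: le_trans (walk q a qp) _.
have sz : (size q).+1 = #|a :: q| by apply/esym/card_uniqP.
have : 2 ^+ (size q).+1 <= 2 ^+ #|W| :> R.
  by rewrite ler_eXn2l ?sz ?max_card //; lra.
rewrite exprS => /(ler_wpM2r S0); lra.
Qed.

End Cube.

Section ProductComparison.
Variables (R : realType) (n : nat) (W : finType) (Gs : 'I_n -> sgraph W).
Variable f : {set {ffun 'I_n -> W}} -> R.
Hypothesis Gs_connected : forall i, connected_graph (Gs i).
Implicit Types (x y u v : {ffun 'I_n -> W}).

Definition update x i a : {ffun 'I_n -> W} := [ffun j => if j == i then a else x j].

Lemma mix1 x y i : mix x y [set i] = update x i (y i).
Proof.
by apply/ffunP => j; rewrite !ffunE inE; case: eqP => // ->.
Qed.

Lemma update_id x i : update x i (x i) = x.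
Proof. by apply/ffunP => j; rewrite !ffunE; case: eqP => // ->. Qed.

Lemma update_update x i a b : update (update x i a) i b = update x i b.
Proof. by apply/ffunP => j; rewrite !ffunE; case: eqP. Qed.

Lemma update_at x i a : update x i a i = a.
Proof. by rewrite ffunE eqxx. Qed.

(** The map sending (x, a) to ([update x i a], x i) is an involution. *)
Lemma sum_update (g : {ffun 'I_n -> W} -> R) i :
  \sum_x \sum_a g (update x i a) = #|W|%:R * \sum_x g x.
Proof.
pose h (p : {ffun 'I_n -> W} * W) := (update p.1 i p.2, p.1 i).
have hK : involutive h.
  by case=> x a; rewrite /h /= update_update update_id update_at.
rewrite mulr_sumr [RHS](eq_bigr (fun x => \sum_(a : W) g x)) => [|x _].
  rewrite !pair_big [LHS](reindex_inj (inv_inj hK)).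
  by apply: eq_bigr => -[x a] _; rewrite /= update_update update_id.
by rewrite sumr_const mulr_natl.
Qed.

Lemma sum_neighbors (g : {ffun 'I_n -> W} -> R) u : (forall v, 0 <= g v) ->
  \sum_i \sum_(b | Gs i (u i) b) g (update u i b) <= \sum_(v | cart_prod Gs u v) g v.
Proof.
move=> g0; rewrite pair_big_dep /=.
pose A := [set p : 'I_n * W | Gs p.1 (u p.1) p.2].
rewrite (eq_bigl (fun p => p \in A)) => [|p]; last by rewrite inE.
have inj : {in A &, injective (fun p : 'I_n * W => update u p.1 p.2)}.
  move=> [i b] [j c]; rewrite !inE /= => ib jc /ffunP e.
  have ij : i = j.
    apply/eqP/negPn/negP => ij; have := e i; rewrite !ffunE eqxx (negPf ij) => bi.
    by move: ib; rewrite bi adj_irrefl.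
  by subst j; have := e i; rewrite !update_at => ->.
rewrite -(big_imset g inj) /=.
rewrite [leRHS](bigID (fun v => v \in [set update u p.1 p.2 | p in A])) /=.
rewrite [X in _ <= X + _](eq_bigl (fun v => v \in [set update u p.1 p.2 | p in A])).
  by rewrite lerDl; apply: sumr_ge0.
move=> v; rewrite andb_idl // => /imsetP[[i b]]; rewrite inE /= => ib ->.
apply/existsP; exists i; rewrite update_at ib /=.
by apply/forallP => j; apply/implyP => /negPf ji; rewrite ffunE ji.
Qed.

(** The factor 40 comes from the cube and 2^|W| from a path inside a line. Each line is counted from
    its |W| points, and the remaining factor counts the endpoints [y], of which only one coordinate
    matters. *)
Lemma product_comparison :
  \sum_x \sum_y exch_energy f x y <=
  40 * 2 ^+ #|W| * #|W|%:R * #|{ffun 'I_n -> W}|%:R *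
    \sum_x \sum_(y | cart_prod Gs x y) exch_energy f x y.
Proof.
apply: le_trans (antipodal_coordinate f) _.
rewrite -!mulrA ler_pM2l //.
pose g i u := \sum_(b | Gs i (u i) b) exch_energy f u (update u i b).
have line x y i : exch_energy f x (mix x y [set i]) <=
    2 ^+ #|W| * \sum_a g i (update x i a).
  rewrite mix1 -{1}(update_id x i).
  have := @connected_energy R W (Gs i)
    (fun a b => exch_energy f (update x i a) (update x i b)) (Gs_connected i).
  move=> /(_ _ _ _ (x i) (y i))/le_trans; apply.
  - by move=> a b; apply: exch_energy_ge0.
  - by move=> a; apply: exch_energyxx.
  - by move=> a b c; apply: exch_energy_triangle.
  rewrite le_eqVlt; apply/orP; left; apply/eqP; congr (_ * _); apply: eq_bigr => a _.
  by rewrite /g update_at; apply: eq_bigr => b _; rewrite update_update.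
apply: le_trans (_ : _ <= \sum_i 2 ^+ #|W| * #|{ffun 'I_n -> W}|%:R *
                            (#|W|%:R * \sum_x g i x)) _.
  apply: ler_sum => i _; rewrite -(sum_update _ i) mulr_sumr; apply: ler_sum => x _.
  apply: le_trans (ler_sum _ (fun y _ => line x y i)) _.
  by rewrite sumr_const -[_ *+ _]mulr_natl mulrA (mulrC _%:R). 
rewrite -mulr_sumr -mulr_sumr -mulrA ler_pM2l ?exprn_gt0 //.
rewrite [leRHS]mulrCA ler_wpM2l ?ler0n // ler_wpM2l ?ler0n //.
rewrite exchange_big; apply: ler_sum => x _; apply: sum_neighbors => v.
exact: exch_energy_ge0.
Qed.

End ProductComparison.

(** * The log-Sobolev inequality on the complete graph *)

Section CompleteGraph.
Variables (R : realType) (V : finType).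
Implicit Types (S P : {set V}) (f g : {set V} -> R).

Lemma ln_ratio_le (a b : R) : 0 < a -> 0 < b -> ln a - ln b <= a / b - 1.
Proof.
move=> a0 b0; rewrite -ln_div ?posrE //.
have ab0 : 0 < a / b by rewrite divr_gt0.
have := @le_ln1Dx R (a / b - 1); rewrite subrKC; apply; lra.
Qed.

(** The bound ln z <= z - 1 around the mean density [m] replaces entropy by variance over mean. In
    the square roots [s] and [t] of the densities, the deficit is then (s - t)^2 times a nonnegative
    polynomial. *)
Lemma two_point_entropy (a b c1 c0 : R) : 0 < a -> 0 < b -> 0 < c1 -> 0 < c0 ->
  a * ln (a / c1) + b * ln (b / c0) - (a + b) * ln ((a + b) / (c1 + c0)) <=
  2 * (c1 + c0) * (Num.sqrt (a / c1) - Num.sqrt (b / c0)) ^+ 2.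
Proof.
move=> a0 b0 c10 c00; set s := Num.sqrt (a / c1); set t := Num.sqrt (b / c0).
have s2 : s ^+ 2 = a / c1 by rewrite sqr_sqrtr // divr_ge0 // ltW.
have t2 : t ^+ 2 = b / c0 by rewrite sqr_sqrtr // divr_ge0 // ltW.
have s0 : 0 <= s := sqrtr_ge0 _; have t0 : 0 <= t := sqrtr_ge0 _.
have aE : a = c1 * s ^+ 2 by rewrite s2; field; lra.
have bE : b = c0 * t ^+ 2 by rewrite t2; field; lra.
pose m := (a + b) / (c1 + c0).
have m0 : 0 < m by rewrite divr_gt0 ?addr_gt0.
have mC : m * (c1 + c0) = c1 * s ^+ 2 + c0 * t ^+ 2 by rewrite -aE -bE /m; field; lra.
have h1 := ln_ratio_le (divr_gt0 a0 c10) m0.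
have h2 := ln_ratio_le (divr_gt0 b0 c00) m0.
have {h1}h1 := ler_wpM2l (ltW a0) h1; have {h2}h2 := ler_wpM2l (ltW b0) h2.
apply: le_trans (_ : _ <= a * (a / c1 / m - 1) + b * (b / c0 / m - 1)) _.
  by rewrite -/m; lra.
rewrite -s2 -t2 -(ler_pM2l (mulr_gt0 m0 (addr_gt0 c10 c00))) -subr_ge0.
have -> : m * (c1 + c0) * (2 * (c1 + c0) * (s - t) ^+ 2) -
    m * (c1 + c0) * (a * (s ^+ 2 / m - 1) + b * (t ^+ 2 / m - 1)) =
    2 * (c1 + c0) * (s - t) ^+ 2 * (m * (c1 + c0)) -
    (c1 + c0) * (a * s ^+ 2 + b * t ^+ 2) + m * (c1 + c0) * (a + b).
  by field; lra.
rewrite mC aE bE.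
have -> : 2 * (c1 + c0) * (s - t) ^+ 2 * (c1 * s ^+ 2 + c0 * t ^+ 2) -
    (c1 + c0) * (c1 * s ^+ 2 * s ^+ 2 + c0 * t ^+ 2 * t ^+ 2) +
    (c1 * s ^+ 2 + c0 * t ^+ 2) * (c1 * s ^+ 2 + c0 * t ^+ 2) =
    (s - t) ^+ 2 * (2 * c1 ^+ 2 * s ^+ 2 + 2 * c0 ^+ 2 * t ^+ 2 + c1 * c0 * (s - t) ^+ 2).
  by ring.
by do ?[exact: sqr_ge0 | exact: ltW | apply: addr_ge0 | apply: mulr_ge0].
Qed.

(** The reverse triangle inequality in l^2; [key] exhibits the deficit as a sum of squares. *)
Lemma sqrt_sum_triangle (I : finType) (A : pred I) (u v : I -> R) :
  (forall i, A i -> 0 <= u i) -> (forall i, A i -> 0 <= v i) ->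
  0 < \sum_(i | A i) u i ^+ 2 -> 0 < \sum_(i | A i) v i ^+ 2 ->
  (Num.sqrt (\sum_(i | A i) u i ^+ 2) - Num.sqrt (\sum_(i | A i) v i ^+ 2)) ^+ 2 <=
  \sum_(i | A i) (v i - u i) ^+ 2.
Proof.
move=> u0 v0 U0 W0; set U := \sum_(i | _) _ in U0 *; set W := \sum_(i | _) _ in W0 *.
pose s := Num.sqrt U; pose t := Num.sqrt W.
have s0 : 0 < s by rewrite sqrtr_gt0.
have t0 : 0 < t by rewrite sqrtr_gt0.
have sU : s ^+ 2 = U by rewrite sqr_sqrtr // ltW.
have tW : t ^+ 2 = W by rewrite sqr_sqrtr // ltW.
have key : s * t * \sum_(i | A i) (v i - u i) ^+ 2 =
    s * t * (s - t) ^+ 2 + \sum_(i | A i) (t * u i - s * v i) ^+ 2.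
  transitivity (s * t * (W + U - 2 * \sum_(i | A i) u i * v i)).
    congr (_ * _); rewrite /W /U mulr_sumr -big_split -sumrB.
    by apply: eq_bigr => i _ /=; ring.
  have -> : \sum_(i | A i) (t * u i - s * v i) ^+ 2 =
      t ^+ 2 * U + s ^+ 2 * W - 2 * s * t * \sum_(i | A i) u i * v i.
    rewrite /W /U !mulr_sumr -big_split -sumrB.
    by apply: eq_bigr => i _ /=; ring.
  rewrite -sU -tW; ring.
rewrite -(ler_pM2l (mulr_gt0 s0 t0)) key lerDl.
by apply: sumr_ge0 => i _; apply: sqr_ge0.
Qed.

Definition slice P (k : nat) : {set {set V}} :=
  [set S : {set V} | (S \subset P) && (#|S| == k)].

(** The entropy times the number of configurations: without normalisation, the chain rule adds the
    two conditional entropies with no weights. A general [P] lets the induction remove sites. *)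
Definition slice_entropy P k f : R :=
  \sum_(S in slice P k) f S * ln (f S) -
  (\sum_(S in slice P k) f S) * ln ((\sum_(S in slice P k) f S) / #|slice P k|%:R).

Definition hop (x y : V) S : {set V} := y |: (S :\ x).

Definition slice_energy P k g : R :=
  \sum_(S in slice P k) \sum_(x in S) \sum_(y in P :\: S) (g (hop x y S) - g S) ^+ 2.

Lemma card_slice P k : #|slice P k| = 'C(#|P|, k).
Proof. exact: cards_draws. Qed.

Lemma sum_slice_in P k i (h : {set V} -> R) : i \in P -> (0 < k)%N ->
  \sum_(S in slice P k | i \in S) h S = \sum_(S in slice (P :\ i) k.-1) h (i |: S).
Proof.
move=> iP k0; rewrite (reindex_onto (fun S => i |: S) (fun S => S :\ i)) /=; last first.
  by move=> S /andP[_ iS]; rewrite setD1K.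
apply: eq_bigl => S; rewrite !inE eqxx andbT subUset sub1set iP /= subsetD1.
have [iS|iS] := boolP (i \in S).
  rewrite andbF; apply/negP => /andP[_ /eqP/setP/(_ i)].
  by rewrite !inE iS eqxx.
rewrite cardsU1 iS setU1K // eqxx !andbT add1n; case: (k) k0 => //.
Qed.

Lemma sum_slice_notin P k i (h : {set V} -> R) :
  \sum_(S in slice P k | i \notin S) h S = \sum_(S in slice (P :\ i) k) h S.
Proof.
by apply: eq_bigl => S; rewrite !inE subsetD1 -!andbA; congr (_ && _); rewrite andbC.
Qed.

Lemma sum_slice P k i (h : {set V} -> R) : i \in P -> (0 < k)%N ->
  \sum_(S in slice P k) h S =
  \sum_(S in slice (P :\ i) k.-1) h (i |: S) + \sum_(S in slice (P :\ i) k) h S.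
Proof.
by move=> iP k0; rewrite (bigID (fun S : {set V} => i \in S)) /= sum_slice_in // sum_slice_notin.
Qed.

Lemma slice_energy_ge0 P k g : 0 <= slice_energy P k g.
Proof. by do 3!(apply: sumr_ge0 => ? _); apply: sqr_ge0. Qed.

Lemma slice_entropy_degenerate P k f : (#|slice P k| <= 1)%N -> slice_entropy P k f = 0.
Proof.
rewrite /slice_entropy; case e: #|slice P k| => [|[|//]] _.
  by rewrite (cards0_eq e) !big_set0 mul0r subrr.
have /cards1P[S ->] : #|slice P k| == 1%N by rewrite e.
by rewrite !big_set1 divr1 subrr.
Qed.

Lemma slice_entropy_chain P k f i : i \in P -> (0 < k < #|P|)%N ->
  let a := \sum_(S in slice (P :\ i) k.-1) f (i |: S) in
  let b := \sum_(S in slice (P :\ i) k) f S in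
  let c1 := #|slice (P :\ i) k.-1|%:R in
  let c0 := #|slice (P :\ i) k|%:R in
  slice_entropy P k f = slice_entropy (P :\ i) k.-1 (fun S => f (i |: S)) +
    slice_entropy (P :\ i) k f +
    (a * ln (a / c1) + b * ln (b / c0) - (a + b) * ln ((a + b) / (c1 + c0))).
Proof.
move=> iP /andP[k0 kP] a b c1 c0.
have -> : c1 + c0 = #|slice P k|%:R.
  rewrite -natrD !card_slice (cardsD1 i P) iP add1n.
  by case: (k) k0 => // k' _; rewrite binS addnC.
by rewrite /slice_entropy !(sum_slice _ iP k0) -/a -/b; ring.
Qed.

Lemma hop_in P k i S y : S \in slice P k -> i \in S -> y \in P :\: S ->
  [/\ hop i y S \in slice P k, y \in hop i y S, i \notin hop i y S &
      hop y i (hop i y S) = S].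
Proof.
rewrite inE => /andP[SP /eqP kS] iS; rewrite inE => /andP[yS yP].
have yi : y != i by apply: contraNneq yS => ->.
split.
- rewrite inE subUset sub1set yP (subset_trans (subD1set _ _) SP) /=.
  by rewrite cardsU1 !inE (negPf yS) andbF add1n -kS (cardsD1 i S) iS.
- by rewrite /hop inE set11.
- by rewrite /hop !inE eqxx orbF eq_sym.
- have yS' : y \notin S :\ i by rewrite !inE (negPf yS) andbF.
  by rewrite /hop setU1K // setD1K.
Qed.

(** A configuration avoiding [i] is reached by moving a particle from [i] in exactly [k] ways, one
    for each site where that particle may have landed. *)
Lemma sum_hop P k f i : i \in P ->
  \sum_(S in slice P k | i \in S) \sum_(y in P :\: S) f (hop i y S) =
  k%:R * \sum_(S in slice P k | i \notin S) f S.
Proof.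
move=> iP; transitivity (\sum_(S in slice P k | i \notin S) \sum_(y in S) f S).
  rewrite !pair_big_dep /=.
  pose h x p : {set V} * V := (hop (x p.2).1 (x p.2).2 p.1, p.2).
  pose to := h (fun y => (i, y)); pose from := h (fun y => (y, i)).
  rewrite [RHS](reindex_onto to from) => [|[S y] /=]; last first.
    move=> /andP[/andP[Sk iS] yS].
    have iPS : i \in P :\: S by rewrite inE iS.
    by have [_ _ _ e] := hop_in Sk yS iPS; rewrite /to /from /h /= e.
  apply: eq_bigl => -[S y] /=; apply/idP/idP.
    move=> /andP[/andP[Sk iS] yPS]; have [m1 m2 m3 e] := hop_in Sk iS yPS.
    by rewrite m1 m2 m3 /from /to /h /= e eqxx.
  move=> /andP[/andP[/andP[Sk iS] yS] /eqP[e]].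
  have iPS : i \in P :\: hop i y S by rewrite inE iS.
  have := hop_in Sk yS iPS; rewrite e => -[m1 m2 m3 _].
  rewrite m1 m2 inE m3 /=; move: Sk; rewrite inE => /andP[/subsetP sP _].
  exact: sP.
rewrite mulr_sumr; apply: eq_bigr => S /andP[]; rewrite inE => /andP[_ /eqP kS] _.
by rewrite sumr_const kS mulr_natl.
Qed.

(** Both conditional means are written as sums over the same pairs (S, y), a particle at [i] and an
    empty site [y]. A set containing [i] appears |P| - k times and a set avoiding it [k] times, so
    the reverse triangle inequality compares them along hops from [i]. *)
Lemma entropy_coordinate P k f i : i \in P -> (0 < k < #|P|)%N ->
  {in slice P k, forall S, 0 < f S} ->
  let a := \sum_(S in slice (P :\ i) k.-1) f (i |: S) in
  let b := \sum_(S in slice (P :\ i) k) f S in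
  let c1 := #|slice (P :\ i) k.-1|%:R in
  let c0 := #|slice (P :\ i) k|%:R in
  (a * ln (a / c1) + b * ln (b / c0) - (a + b) * ln ((a + b) / (c1 + c0)) <=
  2 * #|P|%:R / (k%:R * (#|P| - k)%:R) *
  \sum_(S in slice P k | i \in S) \sum_(y in P :\: S)
     (Num.sqrt (f (hop i y S)) - Num.sqrt (f S)) ^+ 2 : Prop).
Proof.
move=> iP /andP[k0 kP] f0 a b c1 c0.
have cP : #|P| = #|P :\ i|.+1 by rewrite (cardsD1 i P) iP.
have n1 : (0 < #|slice (P :\ i) k.-1|)%N by rewrite card_slice bin_gt0; lia.
have n0 : (0 < #|slice (P :\ i) k|)%N by rewrite card_slice bin_gt0; lia.
have c1_gt0 : 0 < c1 by rewrite ltr0n.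
have c0_gt0 : 0 < c0 by rewrite ltr0n.
have aE : a = \sum_(S in slice P k | i \in S) f S by rewrite sum_slice_in.
have bE : b = \sum_(S in slice P k | i \notin S) f S by rewrite sum_slice_notin.
pose q : R := (#|P| - k)%:R; rewrite -/q.
have k_gt0 : 0 < k%:R :> R by rewrite ltr0n.
have q_gt0 : 0 < q by rewrite ltr0n subn_gt0.
have Nkq : #|P|%:R = k%:R + q by rewrite /q -natrD subnKC // ltnW.
have cq : c1 * q = c0 * k%:R.
  rewrite -!natrM; congr (_%:R); rewrite !card_slice cP.
  case: (k) k0 => // k' _; rewrite subSS mulnC [RHS]mulnC.
  by rewrite mul_bin_left.
have NkC : #|P|%:R * c1 = k%:R * (c1 + c0).
  by rewrite Nkq mulrDl mulrDr (mulrC q) cq (mulrC c0).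
have a_gt0 : 0 < a.
  rewrite aE; have [S0 S0k] := card_gt0P n1.
  have Sk : i |: S0 \in slice P k.
    move: S0k; rewrite !inE subsetD1 => /andP[/andP[sP iS] /eqP cS].
    by rewrite subUset sub1set iP sP /= cardsU1 iS cS; case: (k) k0.
  rewrite (bigD1 (i |: S0)) /=; last by rewrite Sk setU11.
  apply: ltr_wpDr; last exact: f0.
  by apply: sumr_ge0 => S /andP[/andP[Sk' _] _]; apply/ltW/f0.
have b_gt0 : 0 < b.
  rewrite bE; have [S0 S0k] := card_gt0P n0.
  have [Sk iS] : S0 \in slice P k /\ i \notin S0.
    by move: S0k; rewrite !inE subsetD1 => /andP[/andP[-> ->] ->].
  rewrite (bigD1 S0) /=; last by rewrite Sk.
  apply: ltr_wpDr; last exact: f0.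
  by apply: sumr_ge0 => S /andP[/andP[Sk' _] _]; apply/ltW/f0.
apply: le_trans (two_point_entropy a_gt0 b_gt0 c1_gt0 c0_gt0) _.
pose A (p : {set V} * V) := [&& p.1 \in slice P k, i \in p.1 & p.2 \in P :\: p.1].
pose u (p : {set V} * V) := Num.sqrt (f p.1).
pose v (p : {set V} * V) := Num.sqrt (f (hop i p.2 p.1)).
have pairE (F : {set V} * V -> R) :
    \sum_(S in slice P k | i \in S) \sum_(y in P :\: S) F (S, y) = \sum_(p | A p) F p.
  rewrite pair_big_dep; apply: eq_big => [[S y]|[S y] _ //].
  by rewrite /A /= andbA.
have uE : \sum_(p | A p) u p ^+ 2 = q * a.
  rewrite -pairE aE mulr_sumr; apply: eq_bigr => S /andP[Sk _].
  rewrite /u /= sumr_const sqr_sqrtr; last exact/ltW/f0.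
  move: Sk; rewrite inE => /andP[sP /eqP cS].
  by rewrite cardsD (setIidPr sP) cS mulr_natl.
have vE : \sum_(p | A p) v p ^+ 2 = k%:R * b.
  rewrite -pairE bE -(sum_hop k f iP).
  apply: eq_bigr => S /andP[Sk iS]; apply: eq_bigr => y yPS.
  have [m1 _ _ _] := hop_in Sk iS yPS.
  by rewrite /v /= sqr_sqrtr //; apply/ltW/f0.
have tri : (Num.sqrt (q * a) - Num.sqrt (k%:R * b)) ^+ 2 <= \sum_(p | A p) (v p - u p) ^+ 2.
  rewrite -uE -vE; apply: sqrt_sum_triangle; rewrite ?uE ?vE ?mulr_gt0 //.
    by move=> p _; apply: sqrtr_ge0.
  by move=> p _; apply: sqrtr_ge0.
rewrite -(pairE (fun p => (v p - u p) ^+ 2)) /u /v /= in tri.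
move: tri; set X := \sum_(S in _ | _) _; set s := Num.sqrt _; set t := Num.sqrt _ => tri.
have d_gt0 : 0 < c1 * q by rewrite mulr_gt0.
have -> : a / c1 = q * a / (c1 * q) by field; rewrite !lt0r_neq0.
have -> : b / c0 = k%:R * b / (c1 * q) by rewrite cq; field; rewrite !lt0r_neq0.
have sqrtd z : 0 < z -> Num.sqrt (z / (c1 * q)) = Num.sqrt z * Num.sqrt (c1 * q)^-1.
  by move=> z0; rewrite sqrtrM // ltW.
rewrite !sqrtd ?mulr_gt0 // -mulrBl exprMn -/s -/t.
rewrite sqr_sqrtr; last by rewrite invr_ge0 ltW.
have -> : c1 + c0 = #|P|%:R * c1 / k%:R by rewrite NkC; field; rewrite !lt0r_neq0.
set N : R := #|P|%:R.
have -> : 2 * (N * c1 / k%:R) * ((s - t) ^+ 2 / (c1 * q)) =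
   2 * N / (k%:R * q) * (s - t) ^+ 2 by field; rewrite !lt0r_neq0.
apply: ler_wpM2l => //.
by rewrite divr_ge0 ?mulr_ge0 ?ler0n ?ltW.
Qed.

Lemma sliceP P k S : S \in slice P k -> S \subset P /\ #|S| = k.
Proof. by rewrite inE => /andP[? /eqP]. Qed.

Lemma sum_distinct_pairs (A : {set V}) (F : V -> R) :
  \sum_(i in A) \sum_(x in A | x != i) F x = #|A|.-1%:R * \sum_(x in A) F x.
Proof.
rewrite (exchange_big_dep (fun x => x \in A)) /=; last by move=> i x _ /andP[].
rewrite mulr_sumr; apply: eq_bigr => x xA.
rewrite (eq_bigl (fun i => i \in A :\ x)) => [|i]; last first.
  by rewrite !inE xA /= andbC eq_sym.
by rewrite sumr_const mulr_natl (cardsD1 x A) xA.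
Qed.

(** A hop out of [x] survives conditioning on the occupation of each of the k - 1 other occupied
    sites. *)
Lemma slice_energy_in P k g : (0 < k)%N ->
  \sum_(i in P) slice_energy (P :\ i) k.-1 (fun S => g (i |: S)) =
  k.-1%:R * slice_energy P k g.
Proof.
move=> k0; pose D S x := \sum_(y in P :\: S) (g (hop x y S) - g S) ^+ 2.
transitivity (\sum_(i in P) \sum_(S in slice P k | i \in S) \sum_(x in S | x != i) D S x).
  apply: eq_bigr => i iP; rewrite sum_slice_in //.
  apply: eq_bigr => S; rewrite inE subsetD1 => /andP[/andP[SP iS] _].
  apply: eq_big => [x|x xS].
    rewrite !inE; case: eqVneq => [->|] //=; first by rewrite (negPf iS).
    by rewrite andbT.
  have xi : i != x by apply: contraNneq iS => ->.
  rewrite /D; apply: eq_big => [y|y _]; first by rewrite !inE negb_or andbCA andbA.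
  congr ((g _ - _) ^+ 2); apply/setP => z; rewrite !inE.
  by have [->|] := eqVneq z i; rewrite ?(negPf xi) ?xi ?orbT //=; case: (z == y).
rewrite (exchange_big_dep (fun S => S \in slice P k)) /=; last by move=> i S _ /andP[].
rewrite mulr_sumr; apply: eq_bigr => S Sk; have [SP kS] := sliceP Sk.
rewrite (eq_bigl (fun i => i \in S)) => [|i]; last first.
  rewrite Sk /= andb_idl // => iS; exact: (subsetP SP).
by rewrite sum_distinct_pairs kS.
Qed.

(** A hop into [y] survives the removal of each of the |P| - k - 1 other empty sites. *)
Lemma slice_energy_notin P k g :
  \sum_(i in P) slice_energy (P :\ i) k g = (#|P| - k).-1%:R * slice_energy P k g.
Proof.
pose D S y := \sum_(x in S) (g (hop x y S) - g S) ^+ 2.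
transitivity (\sum_(i in P) \sum_(S in slice P k | i \notin S)
    \sum_(y in P :\: S | y != i) D S y).
  apply: eq_bigr => i iP; rewrite sum_slice_notin.
  apply: eq_bigr => S _; rewrite exchange_big /=; apply: eq_bigl => y.
  by rewrite !inE -andbA; congr (_ && _); rewrite andbC.
rewrite (exchange_big_dep (fun S => S \in slice P k)) /=; last by move=> i S _ /andP[].
rewrite mulr_sumr; apply: eq_bigr => S Sk; have [SP kS] := sliceP Sk.
rewrite (eq_bigl (fun i => i \in P :\: S)) => [|i]; last by rewrite Sk in_setD /= andbC.
by rewrite sum_distinct_pairs cardsD (setIidPr SP) kS [in RHS]exchange_big.
Qed.

(* The recursion obtained by averaging the chain rule over the conditioning site
   is solved exactly by the constant [1 / k + 1 / (|P| - k)]. *)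
Lemma slice_log_sobolev P k f : {in slice P k, forall S, 0 < f S} ->
  slice_entropy P k f <=
  2 * (k%:R^-1 + (#|P| - k)%:R^-1) * slice_energy P k (fun S => Num.sqrt (f S)).
Proof.
move En: #|P| => N; elim: N => [|N IH] in P k f En *.
  move=> _; rewrite slice_entropy_degenerate.
    by rewrite mulr_ge0 ?slice_energy_ge0 // mulr_ge0 ?addr_ge0 ?invr_ge0 ?ler0n.
  by rewrite card_slice En bin0n; case: (k).
move=> f0; have [kN|] := boolP (0 < k < N.+1)%N; last first.
  move=> kN; rewrite slice_entropy_degenerate.
    by rewrite mulr_ge0 ?slice_energy_ge0 // mulr_ge0 ?addr_ge0 ?invr_ge0 ?ler0n.
  rewrite card_slice En; move: kN; rewrite negb_and -!leqNgt leqn0.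
  move=> /orP[/eqP->|]; first by rewrite bin0.
  by rewrite leq_eqVlt => /orP[/eqP<-|kN]; rewrite ?binn // bin_small.
have [k0 kN'] := andP kN.
pose g S := Num.sqrt (f S); rewrite -/g.
pose K : R := k%:R; pose Q : R := (N.+1 - k)%:R; rewrite -/K -/Q.
have K0 : 0 < K by rewrite ltr0n.
have Q0 : 0 < Q by rewrite ltr0n subn_gt0.
have NKQ : N.+1%:R = K + Q by rewrite -natrD subnKC // ltnW.
have K1 : k.-1%:R = K - 1 by rewrite /K -[in RHS](prednK k0) -natr1 addrK.
have Q1 : (N.+1 - k).-1%:R = Q - 1.
  by rewrite /Q -[in RHS](@prednK (N.+1 - k)) ?subn_gt0 // -natr1 addrK.
rewrite -(ler_pM2l (ltr0Sn R N)).
set E := slice_energy P k g; have E0 : 0 <= E by apply: slice_energy_ge0.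
have bound i : i \in P -> slice_entropy P k f <=
    2 * (k.-1%:R^-1 + Q^-1) * slice_energy (P :\ i) k.-1 (fun S => g (i |: S)) +
    2 * (K^-1 + (N.+1 - k).-1%:R^-1) * slice_energy (P :\ i) k g +
    2 * N.+1%:R / (K * Q) * \sum_(S in slice P k | i \in S) \sum_(y in P :\: S)
      (g (hop i y S) - g S) ^+ 2.
  move=> iP; have cPi : #|P :\ i| = N by move: En; rewrite (cardsD1 i P) iP => -[].
  have kP : (0 < k < #|P|)%N by rewrite En.
  rewrite (slice_entropy_chain f iP kP); apply: lerD; first apply: lerD.
  - have := IH _ k.-1 (fun S => f (i |: S)) cPi.
    rewrite (_ : N - k.-1 = N.+1 - k)%N; last by lia.
    apply=> S SPi; apply: f0; move: SPi; rewrite !inE subsetD1 => /andP[/andP[SP iS] /eqP cS].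
    by rewrite subUset sub1set iP SP /= cardsU1 iS cS add1n prednK.
  - have := IH _ k f cPi; rewrite (_ : (N.+1 - k).-1 = N - k)%N; last by lia.
    apply=> S SPi; apply: f0; move: SPi; rewrite !inE subsetD1 => /andP[/andP[-> _] ->] //.
  - by have := entropy_coordinate iP kP f0; rewrite En.
have : \sum_(i in P) slice_entropy P k f <= _ := ler_sum _ bound.
rewrite sumr_const En -[_ *+ N.+1]mulr_natl => /le_trans; apply.
rewrite !big_split /= -!mulr_sumr slice_energy_in // slice_energy_notin En -/E.
have -> : \sum_(i in P) \sum_(S in slice P k | i \in S) \sum_(y in P :\: S)
      (g (hop i y S) - g S) ^+ 2 = E.
  rewrite (exchange_big_dep (fun S => S \in slice P k)) /=; last by move=> i S _ /andP[].
  apply: eq_bigr => S Sk; have [SP _] := sliceP Sk.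
  apply: eq_bigl => i; rewrite Sk /= andb_idl // => iS; exact: (subsetP SP).
rewrite !mulrA -!mulrDl; apply: ler_wpM2r => //.
rewrite NKQ K1 Q1.
(* Here [x] is K - 1 or Q - 1 and may vanish; the inverse of 0 is 0, so only an inequality holds in
   that case. *)
have h (x : R) c : 0 <= x -> 0 <= c -> 2 * (x^-1 + c) * x <= 2 * (1 + c * x).
  move=> x0 c0; have [->|xn0] := eqVneq x 0; first by rewrite !mulr0; lra.
  by rewrite le_eqVlt; apply/orP; left; apply/eqP; field.
have h1 : 2 * ((K - 1)^-1 + Q^-1) * (K - 1) <= 2 * (1 + Q^-1 * (K - 1)).
  by apply: h; rewrite ?invr_ge0 ?(ltW Q0) // -K1 ler0n.
have h2 : 2 * (K^-1 + (Q - 1)^-1) * (Q - 1) <= 2 * (1 + K^-1 * (Q - 1)).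
  by rewrite [K^-1 + _]addrC; apply: h; rewrite ?invr_ge0 ?(ltW K0) // -Q1 ler0n.
apply: le_trans (lerD (lerD h1 h2) (lexx _)) _.
rewrite le_eqVlt; apply/orP; left; apply/eqP; field.
by rewrite !lt0r_neq0.
Qed.

End CompleteGraph.

(** * Exclusion processes *)

Section Exclusion.
Variables (R : realType) (V : finType) (G : sgraph V) (k : nat).
Implicit Types (S : {set V}) (f g : {set V} -> R).

Lemma symdiff_pair (x y : V) S : x \in S -> y \notin S -> symdiff S [set x; y] = hop x y S.
Proof.
move=> xS yS; apply/setP => z; rewrite in_symdiff !inE.
have [->|zx] := eqVneq z x; first rewrite xS /= orbF.
  by apply/esym/negP => /eqP xy; rewrite -xy xS in yS.
by have [->|zy] := eqVneq z y; rewrite /= ?(negPf yS) ?addbF.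
Qed.

(** A boundary edge has one endpoint in [S], which orients it and identifies the edge with a unique
    ordered pair. *)
Lemma sum_edge_boundary S (F : {set V} -> R) :
  \sum_(e in edge_boundary G S) F (symdiff S e) =
  \sum_(x in S) \sum_(y | (y \notin S) && G x y) F (hop x y S).
Proof.
rewrite pair_big_dep /=.
pose A := [set p : V * V | [&& p.1 \in S, p.2 \notin S & G p.1 p.2]].
rewrite [RHS](eq_bigl (fun p => p \in A)) => [|p]; last by rewrite inE.
have inj : {in A &, injective (fun p : V * V => [set p.1; p.2])}.
  move=> [x y] [x' y']; rewrite !inE /= => /and3P[xS yS _] /and3P[xS' yS' _] /setP e.
  have -> : x = x'.
    have := e x; rewrite !inE eqxx /= => /esym/orP[/eqP//|/eqP xy].
    by rewrite -xy xS in yS'.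
  have := e y; rewrite !inE eqxx orbT => /esym/orP[/eqP xy|/eqP-> //].
  by rewrite xy xS' in yS.
rewrite (eq_bigr (fun p => F (symdiff S [set p.1; p.2]))) => [|[x y]]; last first.
  by rewrite inE /= => /and3P[xS yS _]; rewrite symdiff_pair.
rewrite -(big_imset (fun e => F (symdiff S e)) inj) /=; apply: eq_bigl => e.
have card_pair (x y : V) : x \in S -> y \notin S -> #|[set x; y] :&: S| = 1%N.
  move=> xS yS; rewrite (_ : _ :&: _ = [set x]) ?cards1 //.
  apply/setP => z; rewrite !inE andb_orl.
  have [->|_] := eqVneq z x; first by rewrite xS.
  by have [->|_] := eqVneq z y; rewrite /= ?(negPf yS).
rewrite inE; apply/andP/imsetP => [[/imset2P[x y _]]|[[x y]]].
  rewrite !inE /= => xy -> /eqP c1.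
  have yx : G y x by rewrite adj_sym.
  have [xS|xS] := boolP (x \in S); have [yS|yS] := boolP (y \in S).
  - move: c1; rewrite (setIidPl _); last by rewrite subUset !sub1set xS.
    by rewrite cards2; case: eqP xy => [->|]; rewrite ?adj_irrefl.
  - by exists (x, y) => //; rewrite inE xS yS.
  - by exists (y, x); rewrite ?inE ?xS ?yS // setUC.
  - move: c1; rewrite (_ : _ :&: _ = set0) ?cards0 //; apply/setP => z; rewrite !inE.
    by apply/negP => /andP[/orP[]/eqP->]; apply/negP.
rewrite inE /= => /and3P[xS yS xy] ->; split; last by rewrite card_pair.
by apply/imset2P; exists x y; rewrite ?inE.
Qed.

Lemma ksubsetsE : ksubsets V k = slice [set: V] k.
Proof. by apply/setP => S; rewrite !inE subsetT. Qed.

(** Exchanges of equally occupied sites contribute nothing; every other exchange is seen from both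
    of its endpoints, whence the factor 2. *)
Lemma sum_exch_energy (e : rel V) g : symmetric e ->
  \sum_x \sum_(y | e x y)
     exch_energy (fun S => if S \in ksubsets V k then g S else 0) x y =
  2 * \sum_(S in ksubsets V k) \sum_(x in S) \sum_(y | (y \notin S) && e x y)
     (g (hop x y S) - g S) ^+ 2.
Proof.
move=> e_sym; pose D S x y := (g (swap x y S) - g S) ^+ 2.
have energyE x y : exch_energy (fun S => if S \in ksubsets V k then g S else 0) x y =
    \sum_(S in ksubsets V k) D S x y.
  rewrite [RHS]big_mkcond; apply: eq_bigr => S _.
  have -> : (swap x y S \in ksubsets V k) = (S \in ksubsets V k).
    by rewrite !inE card_swap.
  by case: ifP => // _; rewrite subrr expr0n.
have -> : \sum_x \sum_(y | e x y)
     exch_energy (fun S => if S \in ksubsets V k then g S else 0) x y =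
    \sum_(S in ksubsets V k) \sum_x \sum_(y | e x y) D S x y.
  rewrite [RHS]exchange_big; apply: eq_bigr => x _; rewrite [RHS]exchange_big.
  by apply: eq_bigr => y _; apply: energyE.
rewrite mulr_sumr; apply: eq_bigr => S _.
have DE x y : x \in S -> y \notin S -> D S x y = (g (hop x y S) - g S) ^+ 2.
  by move=> xS yS; rewrite /D swap_in_notin.
have D0 x y : (x \in S) = (y \in S) -> D S x y = 0.
  by move=> xy; rewrite /D swap_same // subrr expr0n.
have in_part : \sum_(x in S) \sum_(y | e x y) D S x y =
    \sum_(x in S) \sum_(y | (y \notin S) && e x y) (g (hop x y S) - g S) ^+ 2.
  apply: eq_bigr => x xS; rewrite (bigID (fun y => y \in S)) /= big1 ?add0r => [|y].
    apply: eq_big => [y|y /andP[_ yS]]; [exact: andbC | exact: DE].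
  by move=> /andP[_ yS]; apply: D0; rewrite xS yS.
have out_part : \sum_(x | x \notin S) \sum_(y | e x y) D S x y =
    \sum_(x in S) \sum_(y | (y \notin S) && e x y) (g (hop x y S) - g S) ^+ 2.
  rewrite (exchange_big_dep predT) //= (bigID (fun y => y \in S)) /=.
  rewrite [X in _ + X]big1 ?addr0 => [|y yS]; last first.
    by apply: big1 => x /andP[xS _]; apply: D0; rewrite (negPf xS) (negPf yS).
  apply: eq_bigr => y yS; apply: eq_big => [x|x /andP[xS _]]; first by rewrite e_sym.
  by rewrite -DE // /D swapC.
by rewrite (bigID (fun x => x \in S)) /= in_part out_part; ring.
Qed.

Lemma dirichletE g : dirichlet_ex G k g =
  (4 * #|ksubsets V k|%:R)^-1 * \sum_x \sum_(y | G x y)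
     exch_energy (fun S => if S \in ksubsets V k then g S else 0) x y.
Proof.
rewrite sum_exch_energy; last exact: adj_sym.
rewrite mulrA; congr (_ * _).
  by rewrite !invfM; set x := (#|_|%:R)^-1; field.
apply: eq_bigr => S _; exact: (sum_edge_boundary S (fun T => (g T - g S) ^+ 2)).
Qed.

Lemma dirichlet_ge0 g : 0 <= dirichlet_ex G k g.
Proof.
rewrite mulr_ge0 ?invr_ge0 ?mulr_ge0 ?ler0n //.
by do 2!(apply: sumr_ge0 => ? _); apply: sqr_ge0.
Qed.

Lemma entropyE f : (0 < #|ksubsets V k|)%N ->
  entropy k f = slice_entropy [set: V] k f / #|ksubsets V k|%:R.
Proof.
move=> M0; rewrite /entropy /expect /slice_entropy -ksubsetsE.
set M : R := _%:R; have M_neq0 : M != 0 by rewrite pnatr_eq0 -lt0n.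
by set L := ln _; field.
Qed.

(** The 2 in [slice_log_sobolev] cancels against the ordered pairs of [sum_exch_energy], and the 4
    undoes the normalisation in [dirichletE]. *)
Lemma exclusion_log_sobolev (K : R) :
  (0 < k < #|V|)%N -> 0 <= K ->
  (forall g, \sum_x \sum_y exch_energy g x y <=
             K * \sum_x \sum_(y | G x y) exch_energy g x y) ->
  log_sobolev_ineq G k (4 * K * (k%:R^-1 + (#|V| - k)%:R^-1)).
Proof.
move=> /andP[k0 kV] K0 comparison f f0.
have M0 : (0 < #|ksubsets V k|)%N.
  by rewrite ksubsetsE card_slice bin_gt0 cardsT ltnW.
have := @slice_log_sobolev R V [set: V] k f; rewrite -ksubsetsE cardsT => /(_ f0).
pose g S := Num.sqrt (f S); rewrite -/g entropyE // dirichletE.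
pose g0 S := if S \in ksubsets V k then g S else 0; rewrite -/g0.
have energyE : \sum_x \sum_y exch_energy g0 x y = 2 * slice_energy [set: V] k g.
  rewrite (@sum_exch_energy (fun _ _ => true)) // /slice_energy -ksubsetsE.
  congr (_ * _); apply: eq_bigr => S _; apply: eq_bigr => x _.
  by apply: eq_bigl => y; rewrite !inE andbT.
have := comparison g0; rewrite energyE.
have c0 : 0 <= k%:R^-1 + (#|V| - k)%:R^-1 :> R by rewrite addr_ge0 ?invr_ge0.
have {}M0 : 0 < #|ksubsets V k|%:R :> R by rewrite ltr0n.
set c := _ + _ in c0 *; set M := #|_|%:R in M0 *.
set E := slice_energy _ _ _; set B := \sum_x _ => h1 h2.
rewrite ler_pdivrMr //; apply: le_trans h2 _.
have -> : 4 * K * c * ((4 * M)^-1 * B) * M = c * (K * B) by field; rewrite lt0r_neq0.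
by rewrite -mulrA mulrCA; apply: ler_wpM2l.
Qed.

Lemma eq_dirichlet f g : f =1 g -> dirichlet_ex G k f = dirichlet_ex G k g.
Proof.
move=> fg; congr (_ * _); apply: eq_bigr => S _; apply: eq_bigr => e _.
by rewrite !fg.
Qed.

(* With [A] the mean of [g^2], the bound [ln x <= x - 1] at [x = sqrt A / g]
   gives the entropy of [g^2] at least [2 A - 2 sqrt A E(g)]. *)
Lemma variance_le_entropy g : (0 < #|ksubsets V k|)%N -> (forall S, 0 < g S) ->
  expect k (fun S => g S ^+ 2) - expect k g ^+ 2 <= entropy k (fun S => g S ^+ 2).
Proof.
move=> M0 g0; have {}M0 : 0 < #|ksubsets V k|%:R :> R by rewrite ltr0n.
rewrite /entropy; set A := expect k (fun S => g S ^+ 2); set m := expect k g.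
have A0 : 0 < A.
  rewrite divr_gt0 //; have /card_gt0P[S0 Sk] : (0 < #|ksubsets V k|)%N by rewrite -(ltr0n R).
  rewrite (bigD1 S0) //= ltr_wpDr ?exprn_gt0 //.
  by apply: sumr_ge0 => S _; apply: sqr_ge0.
pose a := Num.sqrt A; have a0 : 0 < a by rewrite sqrtr_gt0.
have aA : a ^+ 2 = A by rewrite sqr_sqrtr // ltW.
have lnA : ln A = 2 * ln a by rewrite -aA lnXn // mulr_natl.
have ptw S : g S ^+ 2 * ln A + 2 * g S ^+ 2 - 2 * a * g S <= g S ^+ 2 * ln (g S ^+ 2).
  have gS := g0 S; have := ln_ratio_le a0 gS.
  rewrite lnA lnXn // -[_ *+ 2]mulr_natl => h.
  have /(ler_wpM2l (ltW (exprn_gt0 2 gS))) := h.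
  rewrite (_ : g S ^+ 2 * (a / g S - 1) = a * g S - g S ^+ 2); last by field; rewrite lt0r_neq0.
  lra.
have : expect k (fun S => g S ^+ 2 * ln A + 2 * g S ^+ 2 - 2 * a * g S) <=
    expect k (fun S => g S ^+ 2 * ln (g S ^+ 2)).
  by rewrite ler_pM2r ?invr_gt0 //; apply: ler_sum.
have -> : expect k (fun S => g S ^+ 2 * ln A + 2 * g S ^+ 2 - 2 * a * g S) =
    A * ln A + 2 * A - 2 * a * m.
  rewrite /A /m /expect sumrB big_split /= -mulr_suml -!mulr_sumr; ring.
have := sqr_ge0 (a - m); rewrite sqrrB aA; lra.
Qed.

(** * Test functions that are linear in the configuration *)

Hypothesis k_range : (0 < k < #|V|)%N.
Variable s : V -> R.
Hypothesis s_sum : \sum_x s x = 0.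

Definition occupation S : R := \sum_(x in S) s x.

Lemma sum_occupation : \sum_(S in ksubsets V k) occupation S = 0.
Proof.
have [k0 kV] := andP k_range.
rewrite (exchange_big_dep predT) //= (eq_bigr (fun x => 'C(#|V|.-1, k.-1)%:R * s x)).
  by rewrite -mulr_sumr s_sum mulr0.
move=> x _; rewrite ksubsetsE sum_slice_in ?inE // sumr_const card_slice.
by rewrite mulr_natl; congr (_ *+ 'C(_, _)); rewrite -cardsT (cardsD1 x [set: V]) inE.
Qed.

(** As [s] sums to 0, the square is minus the sum of s x * s y over [x] inside and [y] outside [S].
    It remains to count the [k]-subsets containing [x] and not [y]. *)
Lemma sum_occupation_sq :
  \sum_(S in ksubsets V k) occupation S ^+ 2 = 'C(#|V|.-2, k.-1)%:R * \sum_x s x ^+ 2.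
Proof.
have [k0 kV] := andP k_range.
have sqE S : occupation S ^+ 2 = - \sum_(x in S) \sum_(y | y \notin S) s x * s y.
  under eq_bigr => x _ do rewrite -mulr_sumr.
  rewrite -mulr_suml -/(occupation S).
  have -> : \sum_(y | y \notin S) s y = - occupation S.
    have := s_sum; rewrite (bigID (fun x => x \in S)) /= -/(occupation S); lra.
  by rewrite mulrN opprK expr2.
under eq_bigr => S _ do rewrite sqE.
rewrite sumrN (exchange_big_dep predT) //=.
have count x : \sum_(S in ksubsets V k | x \in S) \sum_(y | y \notin S) s x * s y =
    - ('C(#|V|.-2, k.-1)%:R * s x ^+ 2).
  rewrite (exchange_big_dep (fun y => y != x)) /=; last first.
    by move=> S y /andP[_ xS]; apply: contraNneq => ->.
  rewrite (eq_bigr (fun y => 'C(#|V|.-2, k.-1)%:R * (s x * s y))) => [|y yx].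
    rewrite -!mulr_sumr.
    have -> : \sum_(y | y != x) s y = - s x.
      have := s_sum; rewrite (bigD1 x) //=; lra.
    by ring.
  rewrite big_mkcondr ksubsetsE sum_slice_in ?inE //= -big_mkcondr.
  under eq_bigl => S do rewrite in_setU1 negb_or yx.
  rewrite sum_slice_notin sumr_const card_slice mulr_natl.
  congr (_ *+ 'C(_, _)); rewrite -[X in _ = X.-2]cardsT (cardsD1 x [set: V]) inE.
  by rewrite (cardsD1 y ([set: V] :\ x)) !inE yx.
by rewrite (eq_bigr _ (fun x _ => count x)) sumrN opprK mulr_sumr.
Qed.

Lemma occupation_hop x y S : x \in S -> y \notin S ->
  occupation (hop x y S) - occupation S = s y - s x.
Proof.
move=> xS yS; rewrite /occupation /hop big_setU1 ?inE ?(negPf yS) ?andbF //=.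
by rewrite (big_setD1 x xS) /=; ring.
Qed.

Lemma log_sobolev_test r : 0 < \sum_x s x ^+ 2 -> log_sobolev_ineq G k r ->
  'C(#|V|.-2, k.-1)%:R * \sum_x s x ^+ 2 <=
  r * (2^-1 * #|ksubsets V k|%:R * \sum_x \sum_(y | G x y) (s y - s x) ^+ 2).
Proof.
move=> s_gt0 lsi; have [k0 kV] := andP k_range.
have M0 : (0 < #|ksubsets V k|)%N.
  by rewrite ksubsetsE card_slice bin_gt0 cardsT ltnW.
(* The shift makes [g] positive and changes neither its variance nor its increments. *)
pose K := 1 + \sum_x `|s x|; pose g S := K + occupation S.
have g0 S : 0 < g S.
  have : `|occupation S| <= \sum_x `|s x|.
    apply: le_trans (ler_norm_sum _ _ _) _; rewrite [leRHS](bigID (fun x => x \in S)) /=.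
    by rewrite lerDl; apply: sumr_ge0.
  by rewrite /g /K => /ler_normlP[]; lra.
have := lsi (fun S => g S ^+ 2) (fun S _ => exprn_gt0 2 (g0 S)).
move=> /(le_trans (variance_le_entropy M0 g0)).
rewrite (@eq_dirichlet _ g) => [|S]; last by rewrite sqrtr_sqr gtr0_norm.
set M := #|ksubsets V k| in M0 *; have MR : 0 < M%:R :> R by rewrite ltr0n.
have -> : expect k (fun S => g S ^+ 2) - expect k g ^+ 2 =
    'C(#|V|.-2, k.-1)%:R * (\sum_x s x ^+ 2) / M%:R.
  have sumK c : \sum_(S in ksubsets V k) c = M%:R * c :> R by rewrite sumr_const mulr_natl.
  have -> : expect k g = K.
    rewrite /expect big_split /= sum_occupation sumK addr0 mulrC mulKf //.
    by rewrite lt0r_neq0.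
  rewrite -sum_occupation_sq /expect.
  have -> : \sum_(S in ksubsets V k) g S ^+ 2 =
      M%:R * K ^+ 2 + \sum_(S in ksubsets V k) occupation S ^+ 2.
    rewrite (eq_bigr (fun S => K ^+ 2 + occupation S ^+ 2 + 2 * K * occupation S)).
      by rewrite !big_split /= -[X in _ + X = _]mulr_sumr sum_occupation sumK mulr0 addr0.
    by move=> S _; rewrite /g; ring.
  by rewrite -/M; field; rewrite lt0r_neq0.
pose X := \sum_(S in ksubsets V k) \sum_(x in S) \sum_(y | (y \notin S) && G x y)
  (s y - s x) ^+ 2.
have -> : dirichlet_ex G k g = (2 * M%:R)^-1 * X.
  congr (_ * _); apply: eq_bigr => S _.
  rewrite (sum_edge_boundary S (fun T => (g T - g S) ^+ 2)).
  apply: eq_bigr => x xS; apply: eq_bigr => y /andP[yS _].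
  by rewrite -(occupation_hop xS yS) /g; congr (_ ^+ 2); ring.
have X0 : 0 <= X by do 3!(apply: sumr_ge0 => ? _); apply: sqr_ge0.
have XY : X <= M%:R * \sum_x \sum_(y | G x y) (s y - s x) ^+ 2.
  rewrite /M mulr_natl -sumr_const; apply: ler_sum => S _.
  rewrite [leRHS](bigID (fun x => x \in S)) /=.
  apply: le_trans (_ : _ <= \sum_(x in S) \sum_(y | G x y) (s y - s x) ^+ 2) _; last first.
    by rewrite lerDl; do 2!(apply: sumr_ge0 => ? _); apply: sqr_ge0.
  apply: ler_sum => x _; rewrite [leRHS](bigID (fun y => y \notin S)) /=.
  rewrite [X in _ <= X + _](eq_bigl (fun y => (y \notin S) && G x y)) => [|y]; last exact: andbC.
  by rewrite lerDl; apply: sumr_ge0 => y _; apply: sqr_ge0.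
have C0 : 0 < 'C(#|V|.-2, k.-1)%:R :> R by rewrite ltr0n bin_gt0; lia.
move: XY; set Y := \sum_x \sum_(y | _) _; set L := _ * \sum_x s x ^+ 2 => XY.
have L0 : 0 < L by rewrite mulr_gt0.
rewrite ler_pdivrMr // => h.
have {}h : L <= r * (2^-1 * X).
  by apply: le_trans h _; rewrite le_eqVlt; apply/orP; left; apply/eqP; field; rewrite lt0r_neq0.
have r0 : 0 <= r.
  rewrite leNgt; apply/negP => r0; have : r * (2^-1 * X) <= 0.
    by apply: mulr_le0_ge0; [exact: ltW | rewrite mulr_ge0 ?invr_ge0].
  by lra.
apply: le_trans h _; apply: ler_wpM2l => //; rewrite -mulrA.
by apply: ler_wpM2l => //; rewrite invr_ge0.
Qed.

End Exclusion.

(** The infimum of the admissible constants is itself admissible: for fixed [f] the condition is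
    closed in [r], and when the Dirichlet form vanishes it does not depend on [r] and holds by
    admissibility of [C]. *)
Lemma inverse_log_sobolev_exists (R : realType) (V : finType) (G : sgraph V) (k : nat)
    (c C : R) :
  log_sobolev_ineq G k C -> (forall r, log_sobolev_ineq G k r -> c <= r) ->
  exists rho : R,
    [/\ is_inverse_log_sobolev_constant G k rho, c <= rho & rho <= C].
Proof.
move=> lsiC lsi_c; pose A := log_sobolev_ineq G k : classical_sets.set R.
have A0 : classical_sets.nonempty A by exists C.
have A_lb : classical_sets.has_lbound A by exists c => r /lsi_c.
have inf_le r : log_sobolev_ineq G k r -> inf A <= r.
  by move=> lr; apply: ge_inf.
exists (inf A); split; [|by apply: lb_le_inf => // r /lsi_c|exact: inf_le].
split=> // f f0; set D := dirichlet_ex G k _.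
have : 0 <= D by apply: dirichlet_ge0.
rewrite le_eqVlt => /orP[/eqP D0|D0]; first by have := lsiC f f0; rewrite -/D -D0 !mulr0.
rewrite -ler_pdivrMr //; apply: lb_le_inf => // r /(_ f f0).
by rewrite ler_pdivrMr.
Qed.

(** * The charge of two layers in one direction of the product *)

Section ProductTest.
Variables (R : realType) (n : nat) (W : finType) (Gs : 'I_n -> sgraph W) (i : 'I_n).
Variables a0 a1 : W.
Hypothesis a01 : a0 != a1.

Definition layer_sign (a : W) : R := (a == a0)%:R - (a == a1)%:R.

Definition layer_charge (x : {ffun 'I_n -> W}) : R := layer_sign (x i).

Lemma card_W_gt0 : 0 < #|W|%:R :> R.
Proof. by rewrite ltr0n; apply/card_gt0P; exists a0. Qed.

Lemma sum_layer (h : R -> R) :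
  #|W|%:R * \sum_x h (layer_charge x) = #|{ffun 'I_n -> W}|%:R * \sum_a h (layer_sign a).
Proof.
rewrite -(sum_update _ i).
under eq_bigr => x _ do under eq_bigr => a _ do rewrite /layer_charge update_at.
by rewrite sumr_const mulr_natl.
Qed.

Lemma sum_layer_charge : \sum_x layer_charge x = 0.
Proof.
apply/eqP; rewrite -(mulrI_eq0 _ (mulfI (lt0r_neq0 card_W_gt0))) (sum_layer id) /=.
rewrite sumrB (bigD1 a0) //= eqxx big1 => [|a /negPf->//].
by rewrite (bigD1 a1) //= eqxx big1 => [|a /negPf->//]; rewrite subrr mulr0.
Qed.

Lemma sum_layer_charge_sq :
  #|W|%:R * \sum_x layer_charge x ^+ 2 = 2 * #|{ffun 'I_n -> W}|%:R.
Proof.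
rewrite (sum_layer (fun t => t ^+ 2)) mulrC; congr (_ * _).
rewrite (bigD1 a0) //= (bigD1 a1) 1?eq_sym //= big1 => [|a /andP[/negPf h0 /negPf h1]].
  by rewrite /layer_sign !eqxx (negPf a01) eq_sym (negPf a01) /=; ring.
by rewrite /layer_sign h0 h1 subrr expr0n.
Qed.

(** Edges in directions other than [i] preserve the charge. On the line through [x] in direction [i]
    there are |W| points, and the charge varies by at most 2. *)
Lemma layer_charge_energy :
  \sum_x \sum_(y | cart_prod Gs x y) (layer_charge y - layer_charge x) ^+ 2 <=
  4 * #|W|%:R * #|{ffun 'I_n -> W}|%:R.
Proof.
have sign_le a b : (layer_sign b - layer_sign a) ^+ 2 <= 4.
  rewrite -subr_ge0 (_ : _ - _ = (2 - (layer_sign b - layer_sign a)) *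
    (2 + (layer_sign b - layer_sign a))); last by ring.
  by rewrite /layer_sign; apply: mulr_ge0; do 4!case: eqP => _ /=; lra.
have -> : 4 * #|W|%:R * #|{ffun 'I_n -> W}|%:R =
    \sum_(x : {ffun 'I_n -> W}) 4 * #|W|%:R :> R by rewrite sumr_const mulr_natr.
apply: ler_sum => x _.
pose Y := [set update x i b | b : W].
have upd_inj : injective (update x i).
  by move=> b c /ffunP/(_ i); rewrite !update_at.
apply: le_trans (_ : _ <= \sum_(y in Y) (layer_charge y - layer_charge x) ^+ 2) _.
  rewrite [leRHS](bigID (cart_prod Gs x)) /= [leLHS](bigID (fun y => y \in Y)) /=.
  rewrite [X in _ + X <= _]big1 ?addr0 => [|y /andP[/existsP[j /andP[_ /forallP xy]] yY]].
    rewrite [X in _ <= X + _](eq_bigl (fun y => cart_prod Gs x y && (y \in Y))) => [|y].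
      by rewrite lerDl; apply: sumr_ge0 => y _; apply: sqr_ge0.
    exact: andbC.
  have [ij|ij] := eqVneq i j.
    case/negP: yY; apply/imsetP; exists (y i) => //; apply/ffunP => m; rewrite ffunE.
    case: eqP => [->//|/eqP mi]; apply/esym/eqP.
    by have := xy m; rewrite -ij mi.
  have := xy i; rewrite ij => /eqP e.
  by rewrite /layer_charge e subrr expr0n.
rewrite big_imset /=; last by apply: in2W.
have -> : 4 * #|W|%:R = \sum_(b : W) 4 :> R by rewrite sumr_const mulr_natr.
by apply: ler_sum => b _; rewrite /layer_charge update_at; apply: sign_le.
Qed.

End ProductTest.

(** Both sides count the [k]-subsets with a marked element and a marked non-element. *)
Lemma mul_bin_twice (N k : nat) : (0 < k < N)%N ->
  ('C(N, k) * (k * (N - k)) = N * N.-1 * 'C(N.-2, k.-1))%N.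
Proof.
case: k => // k; case: N => [|[|N]] //= _.
rewrite -mulnA mul_bin_down subSS [RHS]mulnCA (mul_bin_diag N.+2 k).
by rewrite mulnCA mulnA mulnC mulnCA mulnA.
Qed.

(** * Two-sided bound with explicit constants *)

Theorem corollary5 (R : realType) (eps : R) (l : nat) :
  0 < eps -> eps < 1 -> (2 <= l)%N ->
  exists c C : R, [/\ 0 < c, c <= C &
    forall (n : nat) (Gs : 'I_n -> sgraph 'I_l) (k : nat),
      (1 <= n)%N ->
      (forall i, connected_graph (Gs i)) ->
      eps * #|{ffun 'I_n -> 'I_l}|%:R <= k%:R ->
      k%:R <= (1 - eps) * #|{ffun 'I_n -> 'I_l}|%:R ->
      exists rho : R,
        [/\ is_inverse_log_sobolev_constant (cart_prod Gs) k rho,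
            c <= rho & rho <= C]].
Proof.
move=> eps0 eps1 l2.
have l0 : 0 < l%:R :> R by rewrite ltr0n; lia.
(* The constant of [product_comparison] without its factor [N], the number of vertices, which is
   cancelled by 1 / k + 1 / (N - k) <= 2 / (eps N). *)
pose K1 : R := 40 * 2 ^+ l * l%:R.
have K10 : 0 < K1 by do ?[exact: l0 | exact: exprn_gt0 | apply: mulr_gt0].
pose c := eps ^+ 2 / l%:R ^+ 2; pose C := 8 * K1 / eps.
have c0 : 0 < c by rewrite divr_gt0 ?exprn_gt0.
have C0 : 0 < C by apply: divr_gt0 => //; apply: mulr_gt0.
(* Taking [c + C] as the upper constant makes the order of the two constants immediate. *)
exists c, (c + C); split; [by [] | by rewrite lerDl ltW |].
move=> n Gs k n1 Gs_conn; set N := #|{ffun 'I_n -> 'I_l}| => kl ku.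
have cW : #|'I_l| = l := card_ord l.
have N_gt1 : (1 < N)%N.
  rewrite /N card_ffun !card_ord; apply: (leq_trans l2).
  by rewrite -[leqLHS](expn1 l); apply: leq_pexp2l => //; exact: ltnW l2.
have N0 : 0 < N%:R :> R by rewrite ltr0n ltnW.
have k0 : (0 < k)%N by rewrite -(ltr0n R); apply: lt_le_trans kl; rewrite mulr_gt0.
have kN : (k < N)%N.
  by rewrite -(ltr_nat R); apply: le_lt_trans ku _; rewrite gtr_pMl //; lra.
have q0 : 0 < (N - k)%:R :> R by rewrite ltr0n subn_gt0.
have qE : (N - k)%:R = N%:R - k%:R :> R by rewrite natrB // ltnW.
have kR : 0 < k%:R :> R by rewrite ltr0n.
have ql : eps * N%:R <= (N - k)%:R :> R by rewrite qE; lra.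
have k_range : (0 < k < N)%N by rewrite k0.
have upper : log_sobolev_ineq (cart_prod Gs) k
    (4 * (K1 * N%:R) * (k%:R^-1 + (N - k)%:R^-1)).
  apply: exclusion_log_sobolev => //; first by rewrite mulr_ge0 // ltW.
  move=> g; have := product_comparison g Gs_conn.
  by rewrite cW.
have lower r : log_sobolev_ineq (cart_prod Gs) k r -> c <= r.
  pose i : 'I_n := Ordinal n1.
  pose a0 : 'I_l := Ordinal (ltnW l2); pose a1 : 'I_l := Ordinal l2.
  have a01 : a0 != a1 by [].
  pose s := layer_charge R i a0 a1.
  have s_sum : \sum_x s x = 0 by apply: sum_layer_charge.
  have s_sq : l%:R * \sum_x s x ^+ 2 = 2 * N%:R.
    by have := sum_layer_charge_sq R i a01; rewrite cW.
  have s_pos : 0 < \sum_x s x ^+ 2 by rewrite -(pmulr_rgt0 _ l0) s_sq mulr_gt0.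
  move=> /(log_sobolev_test k_range s_sum s_pos).
  have := layer_charge_energy R Gs i a0 a1; rewrite cW -/s -/N.
  have MC : #|ksubsets {ffun 'I_n -> 'I_l} k|%:R * (k%:R * (N - k)%:R) =
      N%:R * (N%:R - 1) * 'C(N.-2, k.-1)%:R :> R.
    rewrite ksubsetsE card_slice cardsT -/N.
    have -> : N%:R - 1 = N.-1%:R :> R by rewrite -subn1 natrB // ltnW.
    rewrite -!natrM; congr (_%:R).
    exact: mul_bin_twice.
  have M0 : 0 < #|ksubsets {ffun 'I_n -> 'I_l} k|%:R :> R.
    by rewrite ltr0n ksubsetsE card_slice bin_gt0 cardsT ltnW.
  move: MC; set M := #|ksubsets _ _|%:R in M0 *; set D := 'C(_, _)%:R.
  set Y := \sum_x \sum_(y | _) _ => MC energy test.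
  have Y0 : 0 <= Y by do 2!(apply: sumr_ge0 => ? _); apply: sqr_ge0.
  have D0 : 0 <= D by apply: ler0n.
  (* By [MC], D / M is k (N - k) / (N (N - 1)), the probability that one given site is occupied and
     another is empty; both k and N - k are at least eps N. *)
  have epsM : eps ^+ 2 * M <= D.
    have h : eps * N%:R * (eps * N%:R) <= k%:R * (N - k)%:R.
      by apply: ler_pM => //; rewrite mulr_ge0 // ltW.
    have N2 : 0 < N%:R ^+ 2 :> R by rewrite exprn_gt0.
    rewrite -(ler_pM2l N2).
    apply: le_trans (_ : _ <= M * (k%:R * (N - k)%:R)) _.
      rewrite (_ : _ * (_ * M) = M * (eps * N%:R * (eps * N%:R))); last by ring.
      by apply: ler_wpM2l => //; apply: ltW.
    rewrite MC; apply: ler_wpM2r => //; rewrite expr2; apply: ler_wpM2l; first exact: ltW.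
    by rewrite gerBl.
  have r0 : 0 <= r.
    rewrite leNgt; apply/negP => r0.
    have h1 : r * (2^-1 * M * Y) <= 0.
      by apply: mulr_le0_ge0; [exact: ltW | rewrite !mulr_ge0 ?invr_ge0 // ltW].
    have h2 : 0 < D * \sum_x s x ^+ 2.
      rewrite mulr_gt0 //; apply: lt_le_trans epsM.
      by rewrite mulr_gt0 ?exprn_gt0.
    lra.
  have h1 : D * (2 * N%:R) <= l%:R * (r * (2^-1 * M * (4 * l%:R * N%:R))).
    rewrite -s_sq mulrCA; apply: ler_wpM2l; first exact: ltW.
    apply: le_trans test _; apply: ler_wpM2l => //; apply: ler_wpM2l => //.
    by rewrite mulr_ge0 ?invr_ge0 // ltW.
  have h2 : D <= r * l%:R ^+ 2 * M.
    have N20 : 0 < 2 * N%:R :> R by rewrite mulr_gt0.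
    rewrite -(ler_pM2r N20); apply: le_trans h1 _.
    by rewrite le_eqVlt; apply/orP; left; apply/eqP; field.
  rewrite ler_pdivrMr ?exprn_gt0 // -(ler_pM2r M0); exact: le_trans epsM h2.
have [rho [rhoP rho_ge rho_le]] := inverse_log_sobolev_exists upper lower.
exists rho; split=> //; apply: le_trans rho_le _.
apply: le_trans (_ : _ <= C) _; last by rewrite lerDr ltW.
have inv_le (a : R) : 0 < a -> eps * N%:R <= a -> N%:R * a^-1 <= eps^-1.
  by move=> a0 ea; rewrite ler_pdivrMr // ler_pdivlMl.
have h1 := inv_le _ kR kl; have h2 := inv_le _ q0 ql.
rewrite (_ : _ * _ = 4 * K1 * (N%:R * k%:R^-1 + N%:R * (N - k)%:R^-1)); last by ring.
apply: le_trans (_ : _ <= 4 * K1 * (eps^-1 + eps^-1)) _.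
  by apply: ler_wpM2l; [rewrite mulr_ge0 // ltW | exact: lerD].
by rewrite le_eqVlt; apply/orP; left; apply/eqP; rewrite /C; ring.
Qed.
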